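(* Let $R>0$ and $B>0$ be constants. For $m\in\mathbb Z$ and $h>0$, let $\mathcal P_m(h)$ be the operator $$\mathcal P_m(h)=h^2\Bigl[-\frac{d^2}{dr^2}-\frac1r\frac{d}{dr}+\Bigl(\frac mr-\frac{Br}{2h}\Bigr)^2\Bigr]-hB$$ in $L^2((0,R),r\,dr)$, with Dirichlet condition at $r=R$ (and regularity at $r=0$), and let $\lambda^D_{m,0}(h)\le\lambda^D_{m,1}(h)\le\dots$ denote the increasing sequence of its eigenvalues. a) If $m<0$, then $\lambda^D_{m,0}(h)\ge(2|m|-1)hB$. b) If $m\ge0$, then $\lambda^D_{m,k}(h)\ge2hBk$ for every integer $k\ge 0$. In particular, the second eigenvalue satisfies $\lambda^D_{m,1}(h)\ge2hB$. c) If $m\ge0$, then, as $h\to0^+$, $$\lambda^D_{m,0}(h)=2hB\,\frac{\bigl(BR^2/(2h)\bigr)^{m+1}}{m!}\,e^{-BR^2/(2h)}\,\bigl(1+\mathcal O(h)\bigr).$$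
   Context: The operators $\mathcal P_m(h)$ arise from separation of variables in polar coordinates $x_1=r\cos\theta$, $x_2=r\sin\theta$ (angular momentum $m$) for the Dirichlet realization, in the disk $D(0,R)\subset\mathbb R^2$, of $P_-=(hD_{x_1}-A_1)^2+(hD_{x_2}-A_2)^2-hB$ with $D_{x_j}=-i\partial_{x_j}$, $\mathbf A=(A_1,A_2)=\frac B2(-x_2,x_1)$ and constant magnetic field $B$. That is, $\mathcal P_m(h)$ is the restriction of this Dirichlet realization to functions of the form $u(r)e^{im\theta}$, and the spectrum of $P_-$ is the union over $m\in\mathbb Z$ of the spectra of $\mathcal P_m(h)$. In c) the asymptotics are for each fixed $m$; no uniformity in $m$ is claimed. *)

(* Defs.v *)
From HB Require Import structures.
From mathcomp Require Import all_boot all_order all_algebra.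
From mathcomp Require Import all_classical all_reals all_analysis.

Set Implicit Arguments.
Unset Strict Implicit.
Unset Printing Implicit Defensive.

Import Order.TTheory GRing.Theory Num.Theory.
Import numFieldNormedType.Exports.

Local Open Scope classical_set_scope.
Local Open Scope ring_scope.

(* Since P_m(h) is self-adjoint with real coefficients, we work with the
   real-valued functions of L^2((0,rho), r dr): the eigenvalues are real and
   a real basis of a real eigenspace is a complex basis of the complex one.
   Functions are total on R; only their values on ]0, rho[ matter. *)

Section RadialOperator.
Context {R : realType}.
Implicit Types (rho B h mu : R) (m : int) (u v w f : R -> R).

(* f belongs to L^2((0, rho), r dr) *)
Definition L2rdr rho f : Prop :=
  measurable_fun `]0, rho[ f /\
  (@lebesgue_measure R).-integrable `]0, rho[ (fun r => (f r ^+ 2 * r)%:E).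

(* v is locally absolutely continuous on ]0, rho[, with a.e. derivative w *)
Definition locAC_with rho v w : Prop :=
  forall a b, 0 < a -> a <= b -> b < rho ->
    (@lebesgue_measure R).-integrable `[a, b] (EFin \o w) /\
    v b - v a = \int[@lebesgue_measure R]_(r in `[a, b]) w r.

(* The differential expression; u1 and u2 stand for u' r and u'' r. *)
Definition Pm_expr B m h r (u0 u1 u2 : R) : R :=
  h ^+ 2 * (- u2 - u1 / r + (m%:~R / r - B * r / (2 * h)) ^+ 2 * u0)
  - h * B * u0.

(* u(r) e^{i m theta} belongs to H^1_0 of the disk of radius rho: in polar
   coordinates |grad (u e^{i m theta})|^2 = u'^2 + (m u / r)^2.  Finiteness of
   this energy at r = 0 is the regularity condition there; for m = 0 it is
   what excludes the solutions behaving like ln r. *)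
Definition radial_H10 rho m u : Prop :=
  [/\ L2rdr rho u, L2rdr rho (derive1 u),
      L2rdr rho (fun r => m%:~R / r * u r)
    & u r @[r --> rho^'-] --> 0].

(* Graph of P_m(h): u is in the domain, i.e. u e^{i m theta} is in H^1_0 and
   P_m(h) u (in the sense of a.e. derivatives) is in L^2, and P_m(h) u = f.
   Elements of the domain are represented by their C^1 representative. *)
Definition Pm_graph rho B m h u f : Prop :=
  exists w : R -> R,
    [/\ forall r, 0 < r < rho -> derivable u r 1,
        locAC_with rho (derive1 u) w,
        radial_H10 rho m u,
        L2rdr rho f
      & {ae @lebesgue_measure R, forall r, 0 < r < rho ->
          f r = Pm_expr B m h r (u r) (derive1 u r) (w r)}].

Definition Pm_eigenspace rho B m h mu u : Prop :=
  Pm_graph rho B m h u (fun r => mu * u r).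

(* lam is the nondecreasing sequence of all the eigenvalues of P_m(h), counted
   with multiplicity: e is a linearly independent family of eigenfunctions,
   e k for lam k, and those e k with lam k = mu span the eigenspace of mu. *)
Definition Pm_eigenvalues rho B m h (lam : nat -> R) : Prop :=
  {homo lam : j k / (j <= k)%N >-> j <= k} /\
  exists e : nat -> R -> R,
    [/\ forall k, Pm_eigenspace rho B m h (lam k) (e k),
        forall n (c : 'I_n -> R),
          (forall r, 0 < r < rho -> \sum_(k < n) c k * e k r = 0) ->
          forall k, c k = 0
      & forall mu u, Pm_eigenspace rho B m h mu u ->
          exists n (c : 'I_n -> R), forall r, 0 < r < rho ->
            u r = \sum_(k < n | lam k == mu) c k * e k r].

End RadialOperator.

(* Main.v *)
Require Import Defs.
From HB Require Import structures.
From mathcomp Require Import all_boot all_order all_algebra.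
From mathcomp Require Import all_classical all_reals all_analysis.
From mathcomp Require Import measurable_realfun.
From mathcomp Require Import ring lra.

Set Implicit Arguments.
Unset Strict Implicit.
Unset Printing Implicit Defensive.

Import Order.TTheory GRing.Theory Num.Theory.
Import numFieldNormedType.Exports.

Local Open Scope classical_set_scope.
Local Open Scope ring_scope.

(** The idea.  Put [b = B / (2 h)] and let [m = n >= 0].  The function
    [u = r^n e^(- b r^2 / 2) g(b r^2)] satisfies [P_m(h) u = 2 h B nu u]
    exactly when [g] solves Kummer's equation
    [t g'' + (n + 1 - t) g' + nu g = 0], and the solution that is regular at
    the origin is the entire function [g(t) = M(- nu, n + 1, t)].  So, with
    [T = B rho^2 / (2 h)], the eigenvalues are the [2 h B nu] for which
    [M(- nu, n + 1, T) = 0], and they are simple ([eigenvalues_kummer]).  This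
    has two halves.  Every eigenfunction is a multiple of the regular solution
    ([eigenfunction_radial_sol]): it is a classical solution because its second
    derivative agrees almost everywhere with a continuous function, its
    Wronskian with the regular solution is a constant [C], finiteness of the
    energy makes [C^2 / r] integrable at [0], so [C = 0].  Conversely, every zero [nu]
    does give an element of the domain ([radial_sol_eigenspace]), which is what
    bounds the lowest eigenvalue from above, since all eigenvalues are listed.

    For [m = - n < 0], expanding the square shows that [P_m(h)] is
    [P_n(h) + 2 n h B], and a zero of [M(- nu, n + 1, .)] on the positive axis
    forces [nu > 0] because otherwise the series has nonnegative coefficients.
    This gives a), in [negative_momentum_bound].

    For b), let [nu_0 < nu_1 < ...] be the zeros in the parameter.  By Sturm
    comparison ([kummer_sturm]) the function [M(- nu_(k+1), n + 1, .)] has a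
    zero strictly between [0] and the first zero of [M(- nu_k, n + 1, .)] and
    strictly between any two of its zeros, and they share the zero [T]; hence
    [M(- nu_k, n + 1, .)] has at least [k + 1] zeros in [(0, T]].  On the
    other hand the derivative of [M(- nu, b, .)] is a multiple of
    [M(- (nu - 1), b + 1, .)], so by Rolle's theorem each zero beyond the
    first costs one unit of [nu], and [k + 1] zeros force [nu > k]
    ([kummer_zeros]).

    For c), expand in the parameter instead: for [0 <= nu <= 1] the value
    [M(- nu, b, T)] lies between [1 - nu S] and [1 - nu S + nu^2 G] for two
    explicit positive series [S] and [G] in [T].  As [S] is
    [n! e^T / T^(n+1) (1 + O(1/T))] while [G / S^2] is exponentially small,
    the first zero in [nu] is
    [1 / S (1 + O(1/T)) = T^(n+1) e^(- T) / n! (1 + O(1/T))], and [1 / T] is a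
    multiple of [h] ([first_zero_asymptotics]). *)

(** * Entire power series and the Kummer function *)

Section EntireSeries.
Context {R : realType}.
Implicit Types (c d : nat -> R) (x y k : R).

Definition entire c := forall x, cvgn (pseries c x).

Definition psum c x : R := limn (pseries c x).

Definition pshift c n : R := if n is n'.+1 then c n' else 0.

Lemma psum_cvg c x : entire c -> pseries c x @ \oo --> psum c x.
Proof. by move=> /(_ x). Qed.

(** Comparison with the exponential series at [A |x|]. *)
Lemma entire_exp_bound (A : R) c :
  (forall n, `|c n| <= A ^+ n / n`!%:R) -> entire c.
Proof.
move=> cA x; apply: normed_cvg.
apply: (@series_le_cvg _ _ (exp_coeff (A * `|x|))) => [n|n|n|].
- exact: normr_ge0.
- rewrite /exp_coeff /= exprMn mulrAC.
  by apply: mulr_ge0; [exact: le_trans (cA n)|exact: exprn_ge0].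
- rewrite /exp_coeff /= exprMn mulrAC normrM normrX.
  by apply: ler_wpM2r => //; exact: exprn_ge0.
- exact: is_cvg_series_exp_coeff.
Qed.

Lemma entireZ k c : entire c -> entire (fun n => k * c n).
Proof.
move=> ec x; rewrite /pseries.
rewrite (_ : (fun _ => _) = k *: (fun n => c n * x ^+ n)).
  by apply: is_cvg_seriesZ; exact: ec.
by apply/funext => n; rewrite /= fctE /= /GRing.scale /= mulrA.
Qed.

Lemma psumZ k c x : entire c -> psum (fun n => k * c n) x = k * psum c x.
Proof.
move=> ec; rewrite /psum /pseries.
rewrite (_ : (fun _ => _) = k *: (fun n => c n * x ^+ n)).
  by rewrite lim_seriesZ//; exact: ec.
by apply/funext => n; rewrite /= fctE /= /GRing.scale /= mulrA.
Qed.

Lemma entireD c d : entire c -> entire d -> entire (fun n => c n + d n).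
Proof.
move=> ec ed x; rewrite /pseries.
rewrite (_ : (fun _ => _) = (fun n => c n * x ^+ n) + (fun n => d n * x ^+ n)).
  by apply: is_cvg_seriesD; [exact: ec|exact: ed].
by apply/funext => n; rewrite /= fctE /= mulrDl.
Qed.

Lemma psumD c d x : entire c -> entire d ->
  psum (fun n => c n + d n) x = psum c x + psum d x.
Proof.
move=> ec ed; rewrite /psum /pseries.
rewrite (_ : (fun _ => _) = (fun n => c n * x ^+ n) + (fun n => d n * x ^+ n)).
  by rewrite lim_seriesD//; [exact: ec|exact: ed].
by apply/funext => n; rewrite /= fctE /= mulrDl.
Qed.

Lemma pseries_pshift c x n : pseries (pshift c) x n.+1 = x * pseries c x n.
Proof.
rewrite /pseries /series /= big_nat_recl//= mul0r add0r mulr_sumr.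
by apply: eq_bigr => i _; rewrite exprS; ring.
Qed.

Lemma psum_pshift_cvg c x : entire c ->
  pseries (pshift c) x @ \oo --> x * psum c x.
Proof.
move=> ec; rewrite -(cvg_shiftS (pseries (pshift c) x)).
rewrite (_ : [sequence _]_n = (fun n => x * pseries c x n)).
  by apply: cvgMr; exact: psum_cvg.
by apply/funext => n; rewrite -pseries_pshift.
Qed.

Lemma entire_pshift c : entire c -> entire (pshift c).
Proof. by move=> ec x; apply/cvg_ex; eexists; exact: psum_pshift_cvg. Qed.

Lemma psum_pshift c x : entire c -> psum (pshift c) x = x * psum c x.
Proof. by move=> ec; apply: cvg_lim => //; exact: psum_pshift_cvg. Qed.

Lemma le_psum c d x : entire c -> entire d ->
  (forall n, c n * x ^+ n <= d n * x ^+ n) -> psum c x <= psum d x.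
Proof. by move=> ec ed cd; apply: lim_series_le; [exact: ec|exact: ed|]. Qed.

Lemma pseries_homo c x : (forall n, 0 <= c n * x ^+ n) ->
  {homo pseries c x : m n / (m <= n)%N >-> m <= n}.
Proof.
move=> c0; apply: (homo_leq (@lexx _ _) (@le_trans _ _)) => n.
by rewrite /pseries seriesSr lerDl; exact: c0.
Qed.

Lemma psum_ge_partial c x n : entire c -> (forall n, 0 <= c n * x ^+ n) ->
  \sum_(0 <= i < n) c i * x ^+ i <= psum c x.
Proof.
by move=> ec c0; apply: nondecreasing_cvgn_le; [exact: pseries_homo|exact: ec].
Qed.

Lemma psum_exp x : psum (fun n => n`!%:R^-1) x = expR x.
Proof. by rewrite expRE. Qed.

Lemma entire_exp : entire (fun n => n`!%:R^-1).
Proof.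
by apply: (@entire_exp_bound 1) => n; rewrite expr1n ger0_norm ?mul1r ?invr_ge0.
Qed.

Lemma is_derive_psum c x : entire c -> entire (pseries_diffs c) ->
  entire (pseries_diffs (pseries_diffs c)) ->
  is_derive x (1 : R) (psum c) (psum (pseries_diffs c) x).
Proof.
move=> e0 e1 e2; apply: (@pseries_snd_diffs _ _ (`|x| + 1)); first exact: e0.
- exact: e1.
- exact: e2.
by rewrite [ltRHS]ger0_norm ?ltrDl// addr_ge0.
Qed.

End EntireSeries.

Section Kummer.
Context {R : realType}.
Implicit Types (a b x nu : R).

Definition poch a n : R := \prod_(i < n) (a + i%:R).

Definition kummer_coef a b n : R := poch a n / (poch b n * n`!%:R).

(** Kummer's confluent hypergeometric function [M(a, b, x)], or [1F1(a; b; x)]. *)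
Definition kummer a b : R -> R := psum (kummer_coef a b).

Lemma poch0 a : poch a 0 = 1. Proof. by rewrite /poch big_ord0. Qed.

Lemma pochSr a n : poch a n.+1 = poch a n * (a + n%:R).
Proof. by rewrite /poch big_ord_recr. Qed.

Lemma pochS a n : poch a n.+1 = a * poch (a + 1) n.
Proof.
rewrite /poch big_ord_recl addr0; congr (_ * _); apply: eq_bigr => i _.
by rewrite /bump /= natrD addrA.
Qed.

Lemma poch_gt0 a n : 0 < a -> 0 < poch a n.
Proof. by move=> a0; apply: prodr_gt0 => i _; rewrite ltr_wpDr. Qed.

Lemma poch_ge0 a n : 0 <= a -> 0 <= poch a n.
Proof. by move=> a0; apply: prodr_ge0 => i _; rewrite addr_ge0. Qed.

Lemma poch_ge_fact b n : 1 <= b -> n`!%:R <= poch b n.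
Proof.
move=> b1; elim: n => [|n IH]; first by rewrite poch0 fact0.
rewrite pochSr factS mulnC natrM; apply: ler_pM => //.
by rewrite -natr1 addrC lerD2r.
Qed.

Lemma kummer_coef0 a b : kummer_coef a b 0 = 1.
Proof. by rewrite /kummer_coef !poch0 fact0 mulr1 divr1. Qed.

(** For [b >= 1] the quotient [(a)_n / (b)_n] of rising factorials is bounded
    factor by factor by [(|a| + j) / (1 + j) <= |a| + 1]. *)
Lemma entire_kummer_coef a b : 1 <= b -> entire (kummer_coef a b).
Proof.
move=> b1; apply: (@entire_exp_bound _ (`|a| + 1)) => n.
have b0 : 0 < b by exact: lt_le_trans b1.
rewrite /kummer_coef invfM mulrA normrM [`|_^-1|]ger0_norm ?invr_ge0//.
rewrite ler_wpM2r ?invr_ge0// normrM normfV ler_pdivrMr ?normr_gt0 ?gt_eqF ?poch_gt0//.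
rewrite (gtr0_norm (poch_gt0 n b0)).
apply: le_trans (_ : (`|a| + 1) ^+ n * n`!%:R <= _); last first.
  by apply: ler_wpM2l; [rewrite exprn_ge0 ?addr_ge0|exact: poch_ge_fact].
elim: n => [|n IH]; first by rewrite poch0 fact0 normr1 mulr1.
rewrite pochSr normrM exprS factS natrM.
rewrite [leRHS](_ : _ = ((`|a| + 1) ^+ n * n`!%:R) * ((`|a| + 1) * n.+1%:R)); last by ring.
apply: ler_pM => //; apply: le_trans (ler_normD _ _) _.
rewrite [`|n%:R|]ger0_norm// -natr1; have := normr_ge0 a; have := ler0n R n; nra.
Qed.

Lemma kummer_diffs a b : 0 < b ->
  pseries_diffs (kummer_coef a b) = (fun n => a / b * kummer_coef (a + 1) (b + 1) n).
Proof.
move=> b0; apply/funext => n.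
rewrite /pseries_diffs /kummer_coef !pochS factS natrM; field.
by rewrite !gt_eqF// ?ltr0n ?fact_gt0 ?poch_gt0 ?ltr_wpDr.
Qed.

Lemma pseries_diffsZ k (c : nat -> R) :
  pseries_diffs (fun n => k * c n) = (fun n => k * pseries_diffs c n).
Proof. by apply/funext => n; rewrite /pseries_diffs mulrCA. Qed.

(** Differentiation raises both parameters by one.  All derivatives of a Kummer
    function are therefore multiples of Kummer functions, and for [a = - nu] the
    parameter [nu] drops by one each time: this is what lets Rolle's theorem
    count zeros. *)
Lemma is_derive_kummer a b x : 1 <= b ->
  is_derive x (1 : R) (kummer a b) (a / b * kummer (a + 1) (b + 1) x).
Proof.
move=> b1; have b0 : 0 < b by exact: lt_le_trans b1.
have b11 : 1 <= b + 1 by rewrite lerDr ltW.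
rewrite /kummer -psumZ; last exact: entire_kummer_coef.
rewrite -kummer_diffs//; apply: is_derive_psum.
- exact: entire_kummer_coef.
- by rewrite kummer_diffs//; apply: entireZ; exact: entire_kummer_coef.
- rewrite kummer_diffs// pseries_diffsZ; apply: entireZ.
  rewrite kummer_diffs ?ltr_wpDr//.
  apply: entireZ; apply: entire_kummer_coef.
  by rewrite lerDr ltW// ltr_wpDr.
Qed.

(** Kummer's equation [x M'' + (b - x) M' - a M = 0], the derivatives being
    written as Kummer functions and the common factor [a / b] divided out.  It
    amounts to a recurrence between neighbouring coefficients, in which
    multiplication by [x] is the index shift. *)
Lemma kummer_ode a b x : 1 <= b ->
  x * ((a + 1) / (b + 1) * kummer (a + 2) (b + 2) x)
  + (b - x) * kummer (a + 1) (b + 1) x - b * kummer a b x = 0.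
Proof.
move=> b1; have b0 : 0 < b by exact: lt_le_trans b1.
have b01 : 0 < b + 1 by rewrite addr_gt0.
have b02 : 0 < b + 2 by rewrite addr_gt0.
have e0 : entire (kummer_coef a b) by exact: entire_kummer_coef.
have e1 : entire (kummer_coef (a + 1) (b + 1)).
  by apply: entire_kummer_coef; rewrite lerDr ltW.
have e2 : entire (kummer_coef (a + 2) (b + 2)).
  by apply: entire_kummer_coef; lra.
have s1 := entire_pshift e1; have s2 := entire_pshift e2.
pose c n := (a + 1) / (b + 1) * pshift (kummer_coef (a + 2) (b + 2)) n +
  (b * kummer_coef (a + 1) (b + 1) n +
   (- 1 * pshift (kummer_coef (a + 1) (b + 1)) n + - b * kummer_coef a b n)).
transitivity (psum c x).
  have z2 : entire (fun n => (a + 1) / (b + 1) * pshift (kummer_coef (a + 2) (b + 2)) n).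
    exact: entireZ.
  have z1 : entire (fun n => b * kummer_coef (a + 1) (b + 1) n) by exact: entireZ.
  have y1 : entire (fun n => - 1 * pshift (kummer_coef (a + 1) (b + 1)) n).
    exact: entireZ.
  have z0 : entire (fun n => - b * kummer_coef a b n) by exact: entireZ.
  rewrite (psumD x z2 (entireD z1 (entireD y1 z0))) (psumD x z1 (entireD y1 z0)).
  rewrite (psumD x y1 z0) !psumZ//.
  by rewrite (psum_pshift x e2) (psum_pshift x e1) /kummer; ring.
suff -> : c = (fun n => 0 * kummer_coef a b n) by rewrite psumZ// mul0r.
apply/funext => -[|n]; rewrite /c /=.
  by rewrite !kummer_coef0; ring.
rewrite mul0r.
have bn : 0 < b + n%:R by rewrite ltr_wpDr.
have bn1 : 0 < b + 1 + n%:R by rewrite ltr_wpDr.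
have pb : 0 < poch (b + 1) n by exact: poch_gt0.
have pb2 : poch (b + 2) n = poch (b + 1) n * (b + 1 + n%:R) / (b + 1).
  rewrite -pochSr pochS mulrAC mulfV ?mul1r ?gt_eqF//.
  by rewrite -addrA.
have pa2 : (a + 1) * poch (a + 2) n = poch (a + 1) n * (a + 1 + n%:R).
  rewrite -pochSr pochS -[a + 1 + 1]addrA.
  by [].
rewrite /kummer_coef (pochS a) (pochS b) (pochSr (a + 1)) (pochSr (b + 1)) factS natrM.
rewrite mulrA -[(a + 1) / _ * _]mulrAC pa2 pb2 -natr1; field.
by rewrite !gt_eqF// ?ltr0n ?fact_gt0 ?poch_gt0 ?ltr_wpDr.
Qed.

(** The form used for eliminating second derivatives. *)
Lemma kummer_ode_snd a b x : 1 <= b ->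
  x * ((a + 1) / (b + 1) * kummer (a + 1 + 1) (b + 1 + 1) x) =
  b * kummer a b x - (b - x) * kummer (a + 1) (b + 1) x.
Proof.
move=> b1; have := kummer_ode a x b1; rewrite -![_ + 1 + 1]addrA => H.
by apply/eqP; rewrite -subr_eq0 -[X in _ == X]H; apply/eqP; ring.
Qed.

(** The coefficients are nonnegative and the first one is [1]. *)
Lemma kummer_gt0 a b x : 1 <= b -> 0 <= a -> 0 <= x -> 0 < kummer a b x.
Proof.
move=> b1 a0 x0; have b0 : 0 < b by exact: lt_le_trans b1.
apply: (@lt_le_trans _ _ (\sum_(0 <= i < 1) kummer_coef a b i * x ^+ i)); last first.
  apply: psum_ge_partial; first exact: entire_kummer_coef.
  move=> n; rewrite mulr_ge0 ?exprn_ge0// divr_ge0 ?poch_ge0//.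
  by rewrite mulr_ge0// poch_ge0// ltW.
by rewrite big_nat1 kummer_coef0 mul1r expr0.
Qed.

End Kummer.

(** * Zeros of Kummer functions in the variable: Rolle and Sturm *)

Section Derivatives.
Context {R : realType}.
Implicit Types (f g : R -> R) (x a b c d : R).

Lemma is_derive_mul f g x a b : is_derive x (1 : R) f a ->
  is_derive x (1 : R) g b ->
  is_derive x (1 : R) (fun t => f t * g t) (a * g x + f x * b).
Proof.
move=> fa gb; apply: (is_derive_eq (is_deriveM fa gb)).
by rewrite /GRing.scale /=; ring.
Qed.

Lemma is_derive_add f g x a b : is_derive x (1 : R) f a ->
  is_derive x (1 : R) g b -> is_derive x (1 : R) (fun t => f t + g t) (a + b).
Proof. by move=> fa gb; exact: is_deriveD fa gb. Qed.

Lemma is_derive_sub f g x a b : is_derive x (1 : R) f a ->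
  is_derive x (1 : R) g b -> is_derive x (1 : R) (fun t => f t - g t) (a - b).
Proof. by move=> fa gb; exact: is_deriveB fa gb. Qed.

Lemma is_derive_scal f x a k : is_derive x (1 : R) f a ->
  is_derive x (1 : R) (fun t => k * f t) (k * a).
Proof. by move=> fa; exact: is_deriveZ fa. Qed.

Lemma is_derive_pow n x :
  is_derive x (1 : R) (fun t => t ^+ n) (n%:R * x ^+ n.-1).
Proof.
elim: n => [|n IH].
  by rewrite mul0r (_ : (fun _ => _) = cst 1)//; exact: is_derive_cst.
rewrite (_ : (fun t => t ^+ n.+1) = (fun t => t * t ^+ n)); last first.
  by apply/funext => t; rewrite exprS.
apply: (is_derive_eq (is_derive_mul (is_derive_id x 1) IH)).
by case: n {IH} => [|n] /=; [rewrite expr0; ring|rewrite exprS; ring].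
Qed.

Lemma is_derive_comp1 f g x a b : is_derive (g x) (1 : R) f a ->
  is_derive x (1 : R) g b -> is_derive x (1 : R) (fun t => f (g t)) (a * b).
Proof. by move=> fa gb; exact: is_derive1_comp. Qed.

Lemma is_derive_derivable f x a : is_derive x (1 : R) f a -> derivable f x 1.
Proof. by case. Qed.

Lemma is_derive1E f x a : is_derive x (1 : R) f a -> derive1 f x = a.
Proof. by move=> fa; rewrite derive1E; exact: derive_val. Qed.

Lemma is_derive_continuous f x a : is_derive x (1 : R) f a -> {for x, continuous f}.
Proof.
by move=> [fa _]; exact/differentiable_continuous/derivable1_diffP.
Qed.

(** Near a zero with positive slope, a function has the sign of [y - c]; this
    determines the sign of one-sided slopes at the two ends of an interval of
    positivity. *)
Lemma is_derive_gt0_near f c d : is_derive c (1 : R) f d -> f c = 0 -> 0 < d ->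
  exists2 e : R, 0 < e & forall y, y != c -> `|y - c| < e -> 0 < (y - c) * f y.
Proof.
move=> [fd fE] fc0 d0.
have : h^-1 *: (f (h *: 1 + c) - f c) @[h --> 0^'] --> d by rewrite -fE; exact: fd.
move=> /cvgr_gt/(_ _ d0)[e /= e0 He].
exists e => // y yc yce.
have yc0 : y - c != 0 by rewrite subr_eq0.
have := He (y - c); rewrite /ball_ /= sub0r normrN => /(_ yce yc0).
rewrite /GRing.scale /= mulr1 subrK fc0 subr0 => H.
have : 0 < (y - c) ^+ 2 * ((y - c)^-1 * f y) by rewrite mulr_gt0// exprn_even_gt0.
by rewrite mulrA expr2 mulfK.
Qed.

Lemma derive_right_end_le0 f a c d : a < c -> is_derive c (1 : R) f d ->
  f c = 0 -> (forall x, a < x < c -> 0 < f x) -> d <= 0.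
Proof.
move=> ac fd fc0 fpos; rewrite leNgt; apply/negP => d0.
have [e e0 He] := is_derive_gt0_near fd fc0 d0.
pose y := c - Num.min e (c - a) / 2.
have m0 : 0 < Num.min e (c - a) by rewrite lt_min e0 subr_gt0.
have me : Num.min e (c - a) <= e by rewrite ge_min lexx.
have ma : Num.min e (c - a) <= c - a by rewrite ge_min lexx orbT.
have yc : y < c by rewrite /y; lra.
have ya : a < y by rewrite /y; lra.
have := He y; rewrite lt_eqF// => /(_ isT).
have -> : `|y - c| = Num.min e (c - a) / 2.
  by rewrite /y addrAC subrr add0r normrN ger0_norm; lra.
have -> : Num.min e (c - a) / 2 < e by lra.
move=> /(_ isT); have := fpos y; rewrite yc ya => /(_ isT) fy.
by rewrite pmulr_lgt0// subr_gt0 ltNge (ltW yc).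
Qed.

Lemma derive_left_end_ge0 f a c d : a < c -> is_derive a (1 : R) f d ->
  f a = 0 -> (forall x, a < x < c -> 0 < f x) -> 0 <= d.
Proof.
move=> ac fd fa0 fpos; rewrite -oppr_le0.
apply: (@derive_right_end_le0 (fun t => f (- t)) (- c) (- a)).
- by rewrite ltrN2.
- rewrite -[- d]mulrN1; apply: is_derive_comp1; by rewrite opprK.
- by rewrite opprK.
- by move=> x /andP[cx xa]; apply: fpos; rewrite ltrNr xa ltrNl.
Qed.

(** The zeros of [f] in [[a, c]] form a compact set, which has a least element. *)
Lemma first_zero f a c : a < c -> continuous f -> f a != 0 -> f c = 0 ->
  exists2 z, a < z <= c & f z = 0 /\ forall x, a <= x < z -> f x != 0.
Proof.
move=> ac cf fa fc.
pose A := `[a, c]%classic `&` f @^-1` [set 0].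
have cA : compact A.
  apply: compact_closedI; first exact: segment_compact.
  by apply: closed_comp => [x _|]; [exact: cf|exact: closed_eq].
have A0 : A !=set0 by exists c; split => //=; rewrite in_itv /= lexx ltW.
have [|z] := @compact_EVT_min _ _ id A A0 cA.
  by apply: continuous_subspaceT => x; exact: cvg_id.
rewrite inE /A /= in_itv /= => -[/andP[az zc] fz] zmin.
exists z.
  rewrite zc andbT lt_neqAle az andbT; apply/eqP => E.
  by move: fa; rewrite E fz eqxx.
split=> // x /andP[ax xz]; apply/eqP => fx.
have : z <= x.
  apply: zmin; rewrite inE /A /=; split => //.
  by rewrite in_itv /= ax (le_trans (ltW xz)).
by rewrite leNgt xz.
Qed.

Lemma last_zero f a c : a < c -> continuous f -> f a = 0 -> f c != 0 ->
  exists2 z, a <= z < c & f z = 0 /\ forall x, z < x <= c -> f x != 0.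
Proof.
move=> ac cf fa fc.
have [||||z /andP[cz za] [fz Hz]] := @first_zero (fun t => f (- t)) (- c) (- a).
- by rewrite ltrN2.
- by move=> x; apply: continuous_comp; [exact: opp_continuous|exact: cf].
- by rewrite opprK.
- by rewrite opprK.
exists (- z); first by rewrite lerNr za ltrNl.
split=> // x /andP[zx xc]; have := Hz (- x).
by rewrite opprK; apply; rewrite lerN2 xc ltrNl.
Qed.

Lemma const_sign f a c : continuous f -> (forall x, a < x < c -> f x != 0) ->
  (forall x, a < x < c -> 0 < f x) \/ (forall x, a < x < c -> f x < 0).
Proof.
move=> cf f0; have [ac|ca] := ltP a c; last first.
  by left => x /andP[ax xc]; move: (lt_trans ax xc); rewrite ltNge ca.
pose m := (a + c) / 2.
have am : a < m by rewrite /m; lra.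
have mc : m < c by rewrite /m; lra.
(* by the intermediate value theorem, a change of sign would produce a zero *)
have key x y : a < x < c -> a < y < c -> 0 < f x -> 0 < f y.
  move=> xac yac fx; rewrite ltNge; apply/negP => fy.
  have [xy|/ltW yx] := leP x y.
    have [|z] := @IVT R f x y 0 xy (continuous_subspaceT cf).
      by rewrite ge_min fy orbT le_max (ltW fx).
    rewrite in_itv /= => /andP[xz zy] fz; have := f0 z.
    rewrite fz eqxx => H; apply/notF/H.
    by case/andP: xac => ax _; case/andP: yac => _ yc; rewrite (lt_le_trans ax)//= (le_lt_trans zy).
  have [|z] := @IVT R f y x 0 yx (continuous_subspaceT cf).
    by rewrite ge_min fy le_max (ltW fx) orbT.
  rewrite in_itv /= => /andP[xz zy] fz; have := f0 z.
  rewrite fz eqxx => H; apply/notF/H.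
  by case/andP: xac => _ ax; case/andP: yac => yc _; rewrite (lt_le_trans yc)//= (le_lt_trans zy).
have mm : a < m < c by rewrite am mc.
have [fm|fm|fm] := ltgtP (f m) 0.
- right => x xac; rewrite ltNge le_eqVlt eq_sym (negbTE (f0 _ xac))/=.
  by apply/negP => fx; have := key _ _ xac mm fx; rewrite ltNge ltW.
- by left => x xac; exact: key mm xac fm.
- by have := f0 _ mm; rewrite fm eqxx.
Qed.

End Derivatives.

Section Zeros.
Context {R : realType}.
Implicit Types (b nu : R).

Lemma continuous_kummer a b : 1 <= b -> continuous (@kummer R a b).
Proof. by move=> b1 x; exact: is_derive_continuous (is_derive_kummer a x b1). Qed.

Lemma kummer_zero_gt0 nu b z : 1 <= b -> 0 <= z -> kummer (- nu) b z = 0 ->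
  0 < nu.
Proof.
move=> b1 z0 fz; rewrite ltNge; apply/negP => nu0.
by have := @kummer_gt0 _ (- nu) b z b1; rewrite oppr_ge0 fz ltxx => /(_ nu0 z0).
Qed.

(** Induction through Rolle's theorem: between consecutive zeros of
    [M(- nu, b, .)] lies a zero of its derivative, a nonzero multiple of
    [M(- (nu - 1), b + 1, .)], which thus has one zero less and parameter
    [nu - 1].  A single zero forces [nu > 0]. *)
Lemma kummer_zeros n nu b (z : nat -> R) : 1 <= b ->
  (forall i, (i <= n)%N -> 0 < z i /\ kummer (- nu) b (z i) = 0) ->
  (forall i, (i < n)%N -> z i < z i.+1) -> n%:R < nu.
Proof.
elim: n nu b z => [|n IH] nu b z b1 z0 zS.
  by have [z00 fz] := z0 0%N isT; exact: kummer_zero_gt0 b1 (ltW z00) fz.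
have nu0 : 0 < nu.
  by have [z00 fz] := z0 0%N isT; exact: kummer_zero_gt0 b1 (ltW z00) fz.
have b0 : 0 < b by exact: lt_le_trans b1.
have [i|c cP] := @choice nat R (fun i c => (i <= n)%N ->
    z i < c < z i.+1 /\ kummer (- nu + 1) (b + 1) c = 0).
  have [ni|] := leqP i n; last by exists 0.
  have fc : {within `[z i, z i.+1], continuous (kummer (- nu) b)}.
    by apply: continuous_subspaceT; exact: continuous_kummer.
  have [||c] := @Rolle R (kummer (- nu) b) (z i) (z i.+1) (zS _ ni) _ fc.
  - by move=> x _; exact: is_derive_derivable (is_derive_kummer _ x b1).
  - by rewrite (z0 i (leqW ni)).2 (z0 i.+1 ni).2.
  rewrite in_itv /= => zc fc0; exists c => _; split => //.
  have /is_derive1E := is_derive_kummer (- nu) c b1.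
  rewrite (is_derive1E fc0) => /esym/eqP.
  by rewrite !mulf_eq0 invr_eq0 oppr_eq0 (gt_eqF nu0) (gt_eqF b0) /= => /eqP.
rewrite -natr1 -ltrBrDr.
apply: (IH (nu - 1) (b + 1) c); first by rewrite lerDr ltW.
- move=> i ni; have [/andP[zc _] fc] := cP i ni; split.
    exact: lt_trans (z0 i (leqW ni)).1 zc.
  by rewrite opprB addrC.
- move=> i ni; have [/andP[_ cz] _] := cP i (ltnW ni).
  by have [/andP[zc _] _] := cP i.+1 ni; exact: lt_trans cz zc.
Qed.

(** A Kummer function that vanished on an interval would have arbitrarily many
    zeros, against the bound above. *)
Lemma kummer_nonzero_in nu b a c : 1 <= b -> 0 <= a -> a < c ->
  exists2 x, a < x < c & kummer (- nu) b x != 0.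
Proof.
move=> b1 a0 ac; apply: contrapT => H.
have f0 x : a < x < c -> kummer (- nu) b x = 0.
  by move=> xac; apply/eqP/negPn/negP => fx; apply: H; exists x.
(* equally spaced points of [(a, c)], more than [nu] of them *)
have [n Hn] : exists n, nu < n%:R by exists (Num.trunc nu).+1; exact: truncnS_gt.
pose z i := a + (c - a) * (i.+1%:R / n.+2%:R).
suff : n%:R < nu by rewrite ltNge (ltW Hn).
apply: (@kummer_zeros n nu b z b1) => i ni.
  have q0 : 0 < i.+1%:R / n.+2%:R :> R by rewrite divr_gt0.
  have q1 : i.+1%:R / n.+2%:R < 1 :> R.
    by rewrite ltr_pdivrMr// mul1r ltr_nat ltnS.
  have az : a < z i by rewrite ltrDl mulr_gt0// subr_gt0.
  split; first exact: le_lt_trans az.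
  apply: f0; rewrite az /z -ltrBrDl -[ltRHS]mulr1 ltr_pM2l// subr_gt0//.
rewrite /z ltrD2l ltr_pM2l ?subr_gt0// ltr_pM2r ?invr_gt0// ltr_nat//.
Qed.

(** The Wronskian of [M(- nu, n + 1, .)] and [M(- nu', n + 1, .)], weighted by
    [t^(n+1) e^(- t)], the factor that puts Kummer's equation in the
    self-adjoint form [(t^(n+1) e^(- t) g')' = - nu t^n e^(- t) g].  The weight
    vanishes at [0], so that [0] serves as an endpoint like a zero of [g]. *)
Definition kummer_wronskian n nu nu' t : R := t ^+ n.+1 * expR (- t) *
  (kummer (- nu) n.+1%:R t * (- nu' / n.+1%:R * kummer (- nu' + 1) (n.+1%:R + 1) t)
   - (- nu / n.+1%:R * kummer (- nu + 1) (n.+1%:R + 1) t) * kummer (- nu') n.+1%:R t).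

Lemma is_derive_expRN (x : R) :
  is_derive x (1 : R) (fun t => expR (- t)) (- expR (- x)).
Proof.
rewrite -mulrN1; apply: is_derive_comp1.
Qed.

Lemma is_derive_kummer_wronskian n nu nu' x :
  is_derive x (1 : R) (kummer_wronskian n nu nu') ((nu - nu') * (x ^+ n * expR (- x) *
    (kummer (- nu) n.+1%:R x * kummer (- nu') n.+1%:R x))).
Proof.
set b : R := n.+1%:R; have b1 : 1 <= b by rewrite ler1n.
have b0 : 0 < b by exact: lt_le_trans b1.
have b11 : 1 <= b + 1 by rewrite lerDr ltW.
have b12 : 0 < b + 1 by exact: lt_le_trans b11.
have D0 k := is_derive_kummer (- k) x b1.
have D1 k := is_derive_scal (- k / b) (is_derive_kummer (- k + 1) x b11).
apply: (is_derive_eq (is_derive_mul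
  (is_derive_mul (is_derive_pow n.+1 x) (is_derive_expRN x))
  (is_derive_sub (is_derive_mul (D0 nu) (D1 nu')) (is_derive_mul (D1 nu) (D0 nu'))))).
rewrite /= exprS -/b.
move: (kummer_ode_snd (- nu) x b1) (kummer_ode_snd (- nu') x b1).
set F := kummer (- nu) b x; set G := kummer (- nu') b x.
set F1 := kummer (- nu + 1) _ x; set G1 := kummer (- nu' + 1) _ x.
set F2 := _ / _ * kummer (- nu + 1 + 1) _ x; set G2 := _ / _ * kummer (- nu' + 1 + 1) _ x.
move=> oF oG.
have -> : b * x ^+ n * expR (- x) + x * x ^+ n * - expR (- x) =
  (b - x) * x ^+ n * expR (- x) by ring.
transitivity (x ^+ n * expR (- x) * ((b - x) * (F * (- nu' / b * G1) - - nu / b * F1 * G)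
  + F * (- nu' / b) * (x * G2) - (- nu / b) * (x * F2) * G)); first by ring.
by rewrite oF oG; field; rewrite gt_eqF.
Qed.

(** Sturm comparison.  If the function with the larger parameter had no zero in
    between, it would have a constant sign there; on an interval where the
    other one is nonzero too, the weighted Wronskian is strictly monotone,
    while the signs of the slopes at the endpoints order its boundary values
    the other way round. *)
Lemma kummer_sturm n nu nu' a c : nu < nu' -> 0 <= a -> a < c ->
  kummer (- nu) n.+1%:R c = 0 -> a = 0 \/ kummer (- nu) n.+1%:R a = 0 ->
  exists2 x, a < x < c & kummer (- nu') n.+1%:R x = 0.
Proof.
set b : R := n.+1%:R; have b1 : 1 <= b by rewrite ler1n.
move=> nn a0 ac fc fa; apply: contrapT => H.
pose f := kummer (- nu) b; pose g := kummer (- nu') b.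
have cf : continuous f by exact: continuous_kummer.
have cg : continuous g by exact: continuous_kummer.
have g0 x : a < x < c -> g x != 0.
  by move=> xac; apply/eqP => gx; apply: H; exists x.
(* shrink to the largest interval around [x0] on which [f] does not vanish *)
have [x0 /andP[ax0 x0c] fx0] := kummer_nonzero_in nu b1 a0 ac.
have [c' /andP[xc' cc'] [fc' fc'0]] := first_zero x0c cf fx0 fc.
have [a' /andP[aa' ax'] [fa' fa'0]] : exists2 a', a <= a' < x0 &
    (a' = 0 \/ f a' = 0) /\ forall x, a' < x <= x0 -> f x != 0.
  have [[y /andP[ay yx] fy]|nz] := pselect (exists2 y, a <= y < x0 & f y = 0).
    have [z /andP[yz zx] [fz zP]] := last_zero yx cf fy fx0.
    by exists z; [rewrite (le_trans ay yz) zx|split=> //; right].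
  exists a; rewrite ?lexx//; split=> // x /andP[ax xx]; apply/eqP => fx.
  apply: nz; exists x => //; rewrite ltW// lt_neqAle xx andbT.
  by apply/eqP => E; move: fx0; rewrite -E -[kummer _ _ _]/(f x) fx eqxx.
have ac' : a' < c' by exact: lt_trans xc'.
have a'0 : 0 <= a' by exact: le_trans aa'.
have nz x : a' < x < c' -> f x * g x != 0.
  move=> /andP[ax xc]; rewrite mulf_neq0//.
    have [xx|/ltW xx] := leP x x0; first by apply: fa'0; rewrite ax.
    by apply: fc'0; rewrite xx.
  by apply: g0; rewrite (le_lt_trans aa' ax) (lt_le_trans xc cc').
have [s s1 sP] : exists2 s : R, s != 0 & forall x, a' < x < c' -> 0 < s * (f x * g x).
  have cfg : continuous (fun x => f x * g x) by move=> x; apply: cvgM; [exact: cf|exact: cg].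
  have [P|P] := const_sign cfg nz; [exists 1|exists (-1)] => //.
  - by move=> x /P; rewrite mul1r.
  - by move=> x /P; rewrite mulN1r oppr_gt0.
pose W x := s * kummer_wronskian n nu nu' x.
have dW x : is_derive x (1 : R) W (s * ((nu - nu') * (x ^+ n * expR (- x) * (f x * g x)))).
  by apply: is_derive_scal; exact: is_derive_kummer_wronskian.
pose f1 x := - nu / b * kummer (- nu + 1) (b + 1) x.
pose g1 x := - nu' / b * kummer (- nu' + 1) (b + 1) x.
have dk x : is_derive x (1 : R) (fun x => s * (f x * g x)) (s * (f1 x * g x + f x * g1 x)).
  by apply: is_derive_scal; apply: is_derive_mul; exact: is_derive_kummer.
have WE x : f x = 0 -> W x = - (x ^+ n.+1 * expR (- x) * (s * (f1 x * g x + f x * g1 x))).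
  move=> fx; rewrite /W /kummer_wronskian -/b -[kummer (- nu) b x]/(f x) fx.
  by rewrite -[kummer (- nu') b x]/(g x) /f1; ring.
have p0 x : 0 <= x -> 0 <= x ^+ n.+1 * expR (- x).
  by move=> x0'; rewrite mulr_ge0 ?expR_ge0// exprn_ge0.
have Wc : 0 <= W c'.
  have kc : s * (f c' * g c') = 0 by rewrite fc' mul0r mulr0.
  have := derive_right_end_le0 ac' (dk c') kc sP; rewrite (WE _ fc') oppr_ge0.
  by move=> h; rewrite mulr_ge0_le0// p0// (le_trans a'0)// ltW.
have Wa : W a' <= 0.
  case: fa' => fa'.
    by rewrite /W /kummer_wronskian fa' exprS !mul0r mulr0.
  have ka : s * (f a' * g a') = 0 by rewrite fa' mul0r mulr0.
  have := derive_left_end_ge0 ac' (dk a') ka sP; rewrite (WE _ fa') oppr_le0.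
  by move=> h; rewrite mulr_ge0// p0.
suff : W c' < W a' by rewrite ltNge (le_trans Wa Wc).
have [|x xac] := @MVT R W _ a' c' ac' (fun x _ => dW x).
  by apply: continuous_subspaceT => x; exact: is_derive_continuous (dW x).
move: xac; rewrite in_itv /= => xac E.
rewrite -subr_lt0 E pmulr_llt0 ?subr_gt0//.
have -> : s * ((nu - nu') * (x ^+ n * expR (- x) * (f x * g x))) =
  (nu - nu') * (x ^+ n * expR (- x)) * (s * (f x * g x)) by ring.
rewrite pmulr_llt0 ?sP// pmulr_llt0 ?subr_lt0//.
rewrite mulr_gt0 ?expR_gt0// exprn_gt0//.
by case/andP: xac => + _; exact: le_lt_trans.
Qed.

(** Each further parameter for which [T] is a zero adds, by Sturm comparison, a
    zero in the variable: for the [k]-th one there are [k + 1] of them. *)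
Lemma kummer_eigenvalue_gt n T k (nu : nat -> R) : 0 < T ->
  (forall i, (i <= k)%N -> kummer (- nu i) n.+1%:R T = 0) ->
  (forall i, (i < k)%N -> nu i < nu i.+1) -> k%:R < nu k.
Proof.
move=> T0 nuT nuS.
suff [z [zT z0 zS]] : exists z : nat -> R, [/\ z k = T,
    forall i, (i <= k)%N -> 0 < z i /\ kummer (- nu k) n.+1%:R (z i) = 0 &
    forall i, (i < k)%N -> z i < z i.+1].
  by apply: (@kummer_zeros k _ _ z _ z0 zS); rewrite ler1n.
elim: k nuT nuS => [|k IH] nuT nuS.
  by exists (fun=> T); split=> // i _; split=> //; exact: nuT.
have [|i ik|z [zT z0 zS]] := IH; first by move=> i ik; apply: nuT; exact: leqW.
  by apply: nuS; exact: leqW.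
have nk := nuS k (ltnSn k).
(* the new zeros [y i] interlace the old ones, the first lying between [0] and [z 0] *)
pose zp i := if i is i'.+1 then z i' else 0.
have [i|y yP] := @choice nat R (fun i y => (i <= k)%N ->
    zp i < y < z i /\ kummer (- nu k.+1) n.+1%:R y = 0).
  have [ik|] := leqP i k; last by exists 0.
  have zp0 : 0 <= zp i by case: i ik => //= i ik; exact: ltW (z0 i (ltnW ik)).1.
  have zpz : zp i < z i.
    by case: i ik {zp0} => /= [|i] ik; [exact: (z0 0%N ik).1|exact: zS].
  have [|y yz fy] := @kummer_sturm n (nu k) (nu k.+1) (zp i) (z i) nk zp0 zpz (z0 i ik).2.
    case: i ik {zp0 zpz} => [|i] ik /=; [by left|right; exact: (z0 i (ltnW ik)).2].
  by exists y.
exists (fun i => if (i <= k)%N then y i else T); split.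
- by rewrite ltnn.
- move=> i ik; case: ifPn => ik'; last by split=> //; exact: nuT.
  have [/andP[zy _] fy] := yP i ik'; split => //; apply: le_lt_trans zy.
  by case: i ik' {ik fy} => //= i ik; exact: ltW (z0 i (ltnW ik)).1.
- move=> i ik; rewrite -ltnS ik; have [/andP[_ yz] _] := yP i ik.
  case: ifPn => ik'.
    by have [/andP[zy _] _] := yP i.+1 ik'; exact: lt_trans yz zy.
  have -> : T = z i; last by [].
  by rewrite -zT; congr z; apply/eqP; rewrite eqn_leq [(k <= i)%N]leqNgt ik' -ltnS ik.
Qed.

End Zeros.

(** * The first zero in the parameter: existence *)

Section FirstZero.
Context {R : realType}.
Implicit Types (b nu x : R) (c d : nat -> R).

Lemma entire_le c d : entire d -> (forall n, `|c n| <= d n) -> entire c.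
Proof.
move=> ed cd x; apply: normed_cvg.
have d0 n : 0 <= d n by exact: le_trans (cd n).
apply: (@series_le_cvg _ _ (fun n => d n * `|x| ^+ n)) => [n|n|n|].
- exact: normr_ge0.
- by rewrite mulr_ge0// exprn_ge0.
- by rewrite /= normrM normrX ler_wpM2r// exprn_ge0.
- exact: ed.
Qed.

Definition one_coef n : R := (n == 0%N)%:R.

Lemma entire_one_coef : entire one_coef.
Proof.
apply: entire_le entire_exp _ => -[|n]; rewrite /one_coef /=.
  by rewrite normr1 fact0 invr1.
by rewrite normr0 invr_ge0.
Qed.

Lemma psum_one x : psum one_coef x = 1.
Proof.
apply: lim_near_cst => //; near=> n.
rewrite -[n]prednK; last by near: n; exists 1%N.
rewrite /pseries /series /= big_nat_recl// big1 ?addr0 ?expr0 ?mulr1//.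
by move=> i _; rewrite /one_coef mul0r.
Unshelve. all: by end_near. Qed.

Lemma psum_ge0 c x : entire c -> (forall n, 0 <= c n) -> 0 <= x -> 0 <= psum c x.
Proof.
move=> ec c0 x0; have := @psum_ge_partial _ c x 0%N ec.
by rewrite big_geq//; apply=> n; rewrite mulr_ge0// exprn_ge0.
Qed.

Lemma le_psum_coef c d x : 0 <= x -> entire c -> entire d ->
  (forall n, c n <= d n) -> psum c x <= psum d x.
Proof.
by move=> x0 ec ed cd; apply: le_psum => // n; rewrite ler_wpM2r// exprn_ge0.
Qed.

Lemma entire_iter_pshift n c : entire c -> entire (iter n pshift c).
Proof. by move=> ec; elim: n => //= n IH; exact: entire_pshift. Qed.

(** Multiplication by [x ^+ n] aligns series in [(n + k)!] with the exponential
    series, so that they can be compared coefficient by coefficient. *)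
Lemma psum_iter_pshift n c x : entire c ->
  psum (iter n pshift c) x = x ^+ n * psum c x.
Proof.
move=> ec; elim: n => [|n IH] /=; first by rewrite expr0 mul1r.
by rewrite psum_pshift ?IH ?exprS ?mulrA//; exact: entire_iter_pshift.
Qed.

Lemma iter_pshiftE n c k : iter n pshift c k = if (k < n)%N then 0 else c (k - n)%N.
Proof.
by elim: n k => [|n IH] [|k] //=.
Qed.

(** [psum (inv_poch b) x] bounds the error of the linear expansion of
    [kummer (- nu) b x] in [nu]; it is also its Lipschitz constant. *)
Definition inv_poch b n : R := (poch b n)^-1.

(** [psum (slope_coef b) x] is minus the derivative of [kummer (- nu) b x] in [nu] at [0]. *)
Definition slope_coef b n : R := if n is n'.+1 then (n%:R * poch b n)^-1 else 0.

Lemma poch1 n : poch 1 n = n`!%:R :> R.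
Proof.
elim: n => [|n IH]; first by rewrite poch0.
by rewrite pochSr IH factS natrM -natr1 mulrC addrC.
Qed.

Lemma inv_pochE b n : inv_poch b n = kummer_coef 1 b n.
Proof. by rewrite /kummer_coef poch1 invfM mulrC mulfVK// gt_eqF// ltr0n fact_gt0. Qed.

Lemma entire_inv_poch b : 1 <= b -> entire (inv_poch b).
Proof.
move=> b1; rewrite (_ : inv_poch b = kummer_coef 1 b); first exact: entire_kummer_coef.
by apply/funext => n; exact: inv_pochE.
Qed.

Lemma inv_poch_ge0 b n : 0 < b -> 0 <= inv_poch b n.
Proof. by move=> b0; rewrite invr_ge0 ltW// poch_gt0. Qed.

Lemma entire_slope_coef b : 1 <= b -> entire (slope_coef b).
Proof.
move=> b1; have b0 : 0 < b by exact: lt_le_trans b1.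
apply: entire_le (entire_inv_poch b1) _ => -[|n]; rewrite /slope_coef /inv_poch.
  by rewrite normr0 invr_ge0 poch0.
have p0 := poch_gt0 n.+1 b0.
rewrite ger0_norm ?invr_ge0 ?mulr_ge0 ?(ltW p0)// invfM ler_piMl ?invr_ge0 ?(ltW p0)//.
by rewrite invf_le1// ler1n.
Qed.

(** The factor by which the coefficients of [kummer (- nu) b] differ from their
    linearization at [nu = 0]. *)
Definition qprod nu n : R := \prod_(i < n) (1 - nu / i.+1%:R).

Lemma qprodS nu n : qprod nu n.+1 = qprod nu n * (1 - nu / n.+1%:R).
Proof. by rewrite /qprod big_ord_recr. Qed.

Lemma poch_qprod nu n : poch (- nu) n.+1 = - nu * n`!%:R * qprod nu n.
Proof.
elim: n => [|n IH]; first by rewrite /poch big_ord_recr big_ord0 /qprod big_ord0 fact0 /=; ring.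
rewrite pochSr IH qprodS factS natrM; field.
by rewrite gt_eqF// ltr_wpDr.
Qed.

Lemma kummer_coefN b nu n : 0 < b ->
  kummer_coef (- nu) b n.+1 = - nu * qprod nu n * slope_coef b n.+1.
Proof.
move=> b0; have p0 := poch_gt0 n.+1 b0.
rewrite /kummer_coef /slope_coef poch_qprod factS natrM; field.
by rewrite !gt_eqF ?ltr0n ?fact_gt0 ?ltr_wpDr.
Qed.

Section unit_interval.
Variables (nu : R) (nu0 : 0 <= nu) (nu1 : nu <= 1).

Lemma factor01 n : 0 <= 1 - nu / n.+1%:R <= 1.
Proof.
rewrite subr_ge0 ler_pdivrMr// mul1r gerBl divr_ge0// andbT.
by rewrite (le_trans nu1)// ler1n.
Qed.

Lemma qprod01 n : 0 <= qprod nu n <= 1.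
Proof.
elim: n => [|n IH]; first by rewrite /qprod big_ord0 ler01 lexx.
case/andP: IH => q0 q1; have /andP[f0 f1] := factor01 n.
by rewrite qprodS mulr_ge0//= mulr_ile1.
Qed.

Lemma qprod_ge n : 1 - n%:R * nu <= qprod nu n.
Proof.
elim: n => [|n IH]; first by rewrite /qprod big_ord0 mul0r subr0.
rewrite qprodS -[in leLHS]natr1; have /andP[q0 q1] := qprod01 n.
have i0 : 0 <= n.+1%:R^-1 :> R by rewrite invr_ge0.
have i1 : n.+1%:R^-1 <= 1 :> R by rewrite invf_le1// ler1n.
have t1 : nu * n.+1%:R^-1 <= nu by rewrite ler_piMr.
have t0 : 0 <= nu * n.+1%:R^-1 by rewrite mulr_ge0.
have qt : qprod nu n * (nu * n.+1%:R^-1) <= nu by rewrite (le_trans _ t1)// ler_piMl.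
rewrite mulrBr mulr1 mulrDl mul1r opprD addrA.
by apply: lerB.
Qed.

End unit_interval.

Lemma qprod_lip nu nu' n : 0 <= nu <= 1 -> 0 <= nu' <= 1 ->
  `|nu * qprod nu n - nu' * qprod nu' n| <= n.+1%:R * `|nu - nu'|.
Proof.
move=> /andP[a0 a1] /andP[b0 b1]; elim: n => [|n IH].
  by rewrite /qprod !big_ord0 !mulr1 mul1r.
have /andP[q0 q1] := qprod01 b0 b1 n.
have /andP[f0 f1] := factor01 a0 a1 n.
have i0 : 0 <= n.+1%:R^-1 :> R by rewrite invr_ge0.
have i1 : n.+1%:R^-1 <= 1 :> R by rewrite invf_le1// ler1n.
rewrite !qprodS.
rewrite (_ : _ - _ = (nu * qprod nu n - nu' * qprod nu' n) * (1 - nu / n.+1%:R)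
  - nu' * qprod nu' n * ((nu - nu') / n.+1%:R)); last by ring.
apply: le_trans (ler_normB _ _) _; rewrite -[n.+2%:R]natr1 [leRHS]mulrDl mul1r lerD//.
  by rewrite normrM (ger0_norm f0) (le_trans _ IH)// ler_piMr.
rewrite !normrM (ger0_norm b0) (ger0_norm q0) (ger0_norm i0).
rewrite -[leRHS]mul1r ler_pM ?mulr_ge0//.
- by rewrite mulr_ile1.
- by rewrite ler_piMr.
Qed.

Section bounds.
Variables (b x : R) (b1 : 1 <= b) (x0 : 0 <= x).
Let b0 : 0 < b. Proof. exact: lt_le_trans b1. Qed.
Let F nu := kummer (- nu) b x.
Let S0 := psum (slope_coef b) x.
Let G := psum (inv_poch b) x.
Let ek nu : entire (kummer_coef (- nu) b). Proof. exact: entire_kummer_coef. Qed.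
Let es : entire (slope_coef b). Proof. exact: entire_slope_coef. Qed.
Let eg : entire (inv_poch b). Proof. exact: entire_inv_poch. Qed.
Let e1 := entire_one_coef.

Lemma slope_coef_ge0 n : 0 <= slope_coef b n.
Proof.
by case: n => //= n; rewrite invr_ge0 mulr_ge0// ltW// poch_gt0.
Qed.

Lemma inv_poch_slope_coef n : inv_poch b n.+1 = n.+1%:R * slope_coef b n.+1.
Proof. by rewrite /inv_poch /slope_coef invfM mulVKf. Qed.

Lemma kummer_ge_linear nu : 0 <= nu <= 1 -> 1 - nu * S0 <= F nu.
Proof.
move=> /andP[nu0 nu1].
rewrite -mulNr -(psumZ (- nu) x es) -(psum_one x) -(psumD x e1 (entireZ es)).
apply: le_psum_coef => //; first by apply: entireD => //; exact: entireZ.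
case=> [|n]; first by rewrite kummer_coef0 /one_coef /= mulr0 addr0.
rewrite /one_coef kummer_coefN//= add0r ler_wpM2r ?(slope_coef_ge0 n.+1)//.
by have /andP[q0 q1] := qprod01 nu0 nu1 n; nra.
Qed.

(** The linearization error is controlled by [1 - qprod nu n <= n nu], and the
    factor [n] is absorbed in passing from [slope_coef] to [inv_poch]. *)
Lemma kummer_le_quadratic nu : 0 <= nu <= 1 -> F nu <= 1 - nu * S0 + nu ^+ 2 * G.
Proof.
move=> /andP[nu0 nu1].
rewrite -mulNr -(psumZ (- nu) x es) -(psumZ (nu ^+ 2) x eg) -(psum_one x).
rewrite -(psumD x e1 (entireZ es)) -(psumD x (entireD e1 (entireZ es)) (entireZ eg)).
apply: le_psum_coef => //.
  by apply: entireD; [apply: entireD => //|]; exact: entireZ.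
case=> [|n].
  by rewrite kummer_coef0 /one_coef /= mulr0 addr0 lerDl mulr_ge0// ?inv_poch_ge0// exprn_ge0.
rewrite /one_coef kummer_coefN// inv_poch_slope_coef add0r mulrA -mulrDl.
rewrite ler_wpM2r ?slope_coef_ge0//.
have := qprod_ge nu0 nu1 n; rewrite -natr1; nra.
Qed.

(** Gives the continuity in the parameter that the intermediate value theorem requires. *)
Lemma kummer_lipschitz nu nu' : 0 <= nu <= 1 -> 0 <= nu' <= 1 ->
  `|F nu - F nu'| <= G * `|nu - nu'|.
Proof.
move=> nuP nuP'; wlog : nu nu' nuP nuP' / F nu' <= F nu.
  by move=> H; have [/H->//|/ltW/H] := leP (F nu') (F nu); rewrite distrC [`|nu' - _|]distrC; exact.
move=> FF; rewrite ger0_norm ?subr_ge0// lerBlDl mulrC.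
rewrite -(psumZ _ x eg) /F -psumD//; last exact: entireZ.
apply: le_psum_coef => //; first by apply: entireD => //; exact: entireZ.
case=> [|n]; first by rewrite !kummer_coef0 lerDl mulr_ge0// inv_poch_ge0.
rewrite !kummer_coefN// inv_poch_slope_coef mulrA -mulrDl ler_wpM2r ?slope_coef_ge0//.
have := qprod_lip n nuP' nuP; rewrite ler_norml => /andP[_].
by rewrite [`|nu' - _|]distrC; lra.
Qed.

Lemma kummer_first_zero_exists s : 0 <= s <= 1 -> F s <= 0 ->
  exists2 nu, 0 <= nu <= s & F nu = 0.
Proof.
move=> /andP[s0 s1] Fs.
have G0 : 0 <= G by apply: psum_ge0 => // n; exact: inv_poch_ge0.
have cF : {within `[0, s], continuous F}.
  apply/subspace_continuousP => y /=; rewrite in_itv /= => /andP[y0 ys].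
  apply/cvgrPdist_le => e e0; near=> z.
  have yI : 0 <= y <= 1 by rewrite y0 (le_trans ys).
  have zI : 0 <= z <= 1.
    have : z \in `[0, s] by near: z; exact: withinT.
    by rewrite in_itv /= => /andP[-> /le_trans]; exact.
  apply: le_trans (kummer_lipschitz yI zI) _.
  apply: le_trans (_ : (G + 1) * `|y - z| <= _).
    by rewrite ler_wpM2r// lerDl.
  rewrite mulrC -ler_pdivlMr ?ltr_wpDl//.
  near: z; apply: cvg_within; exists (e / (G + 1)).
    by rewrite /= divr_gt0// ltr_wpDl.
  by move=> t /= /ltW.
have F0 : F 0 = 1.
  rewrite /F /kummer oppr0 -(psum_one x); congr psum; apply/funext => -[|n].
    by rewrite kummer_coef0.
  by rewrite /kummer_coef pochS !mul0r.
have [|nu] := @IVT R F 0 s 0 s0 cF.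
  by rewrite ge_min Fs orbT le_max F0 ler01.
by rewrite in_itv /=; exists nu.
Unshelve. all: by end_near. Qed.

End bounds.

End FirstZero.

(** * The first zero in the parameter: asymptotics *)

Section Asymptotics.
Context {R : realType}.
Implicit Types (x nu : R).

Lemma poch_fact n k : poch n.+1%:R k * n`!%:R = (n + k)`!%:R :> R.
Proof.
elim: k => [|k IH]; first by rewrite poch0 mul1r addn0.
rewrite pochSr mulrAC IH addnS factS natrM mulrC; congr (_ * _).
by rewrite -natrD addSn.
Qed.

Lemma poch_natE n k : poch n.+1%:R k = (n + k)`!%:R / n`!%:R :> R.
Proof. by rewrite -poch_fact mulfK// gt_eqF// ltr0n fact_gt0. Qed.

Let fact0R n : n`!%:R != 0 :> R.
Proof. by rewrite gt_eqF// ltr0n fact_gt0. Qed.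

Let factR n : 0 < n`!%:R :> R.
Proof. by rewrite ltr0n fact_gt0. Qed.

Lemma inv_poch_sum_le n x : 0 <= x -> x ^+ n * psum (inv_poch n.+1%:R) x <= n`!%:R * expR x.
Proof.
move=> x0; have eg : entire (inv_poch (n.+1%:R : R)) by apply: entire_inv_poch; rewrite ler1n.
rewrite -psum_iter_pshift// -psum_exp -psumZ//; last exact: entire_exp.
apply: le_psum_coef => //; first exact: entire_iter_pshift.
  exact: entireZ entire_exp.
move=> k; rewrite iter_pshiftE; case: ltnP => nk; first by rewrite divr_ge0.
by rewrite /inv_poch poch_natE subnKC// invfM invrK mulrC.
Qed.

Lemma slope_coef_pshift_lt n j : (j < n.+2)%N ->
  iter n.+1 pshift (slope_coef n.+1%:R) j = 0 :> R.
Proof.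
move=> jn; rewrite iter_pshiftE; case: ltnP => // nj.
suff -> : j = n.+1 by rewrite subnn.
by apply/eqP; rewrite eqn_leq nj -ltnS jn.
Qed.

Lemma slope_coef_pshift_ge n k : iter n.+1 pshift (slope_coef n.+1%:R) (n.+2 + k)%N =
  n`!%:R / (k.+1%:R * (n.+1 + k)`!%:R) :> R.
Proof.
rewrite iter_pshiftE (addSnnS n.+1 k) ltnNge leq_addr /= addKn /slope_coef poch_natE -addSnnS.
by field; rewrite !fact0R gt_eqF ?ltr_wpDr.
Qed.

(** The coefficients of [(expR x - 1) / x]. *)
Definition inv_factS k : R := k.+1`!%:R^-1.

Lemma entire_inv_factS : entire inv_factS.
Proof.
apply: (entire_le entire_exp) => k; rewrite /inv_factS ger0_norm ?invr_ge0//.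
by rewrite lef_pV2 ?posrE// ler_nat factS leq_pmull.
Qed.

Lemma inv_factS_sum_le x : 0 <= x -> x * psum inv_factS x <= expR x.
Proof.
move=> x0; rewrite -psum_pshift; last exact: entire_inv_factS.
rewrite -psum_exp; apply: le_psum_coef => //.
- by apply: entire_pshift; exact: entire_inv_factS.
- exact: entire_exp.
- by case=> [|k] //=; rewrite invr_ge0.
Qed.

Let es n : entire (slope_coef (n.+1%:R : R)).
Proof. by apply: entire_slope_coef; rewrite ler1n. Qed.

(** Together with [slope_sum_ge] this says that [x ^+ n.+1 * S], with [S] the slope
    series, is [n! e^x (1 + O(1/x))].  The coefficient of order [j = n + 2 + k]
    is [n! / ((k + 1) (j - 1)!)], which differs from [n! / j!] by at most
    [n! (n + 1) (n + 3) / (j + 1)!]; the latter sums to [O(e^x / x)]. *)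
Lemma slope_sum_le n x : 0 <= x -> x * (x ^+ n.+1 * psum (slope_coef n.+1%:R) x)
  <= n`!%:R * (x + n.+1%:R * n.+3%:R) * expR x.
Proof.
move=> x0; pose C : R := n.+1%:R * n.+3%:R.
have e1 : entire (fun k => n`!%:R * k`!%:R^-1 : R) by apply: entireZ; exact: entire_exp.
have e2 : entire (fun k => (n`!%:R * C) * inv_factS k) by apply: entireZ; exact: entire_inv_factS.
apply: (@le_trans _ _ (x * (n`!%:R * expR x + n`!%:R * C * psum inv_factS x))).
  rewrite ler_wpM2l// -psum_iter_pshift// -psum_exp -psumZ; last exact: entire_exp.
  rewrite -psumZ; last exact: entire_inv_factS.
  rewrite -psumD//; apply: le_psum_coef => //; first exact: entire_iter_pshift.
    exact: entireD.
  move=> j; have [jn|jn] := ltnP j n.+2.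
    rewrite slope_coef_pshift_lt// addr_ge0// ?mulr_ge0// ?invr_ge0//.
  rewrite -(subnKC jn); set k := (j - n.+2)%N.
  rewrite slope_coef_pshift_ge -mulrA -mulrDr ler_wpM2l// /inv_factS.
  have pE : (n.+1 + k)%:R = n%:R + k%:R + 1 :> R by rewrite natrD -natr1; ring.
  have -> : (n.+2 + k)%N = (n.+1 + k).+1 by [].
  move: (n.+1 + k)%N pE => p pE.
  rewrite (factS p.+1) (factS p) !natrM.
  have -> : p.+2%:R = n%:R + k%:R + 3%:R :> R by rewrite -[p.+2%:R]natr1 -[p.+1%:R]natr1 pE; ring.
  have -> : p.+1%:R = n%:R + k%:R + 2%:R :> R by rewrite -[p.+1%:R]natr1 pE; ring.
  have f0 := factR p; move: (p`!%:R) f0 => F f0.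
  have n0 := ler0n R n; have k0 := ler0n R k.
  rewrite -subr_ge0 /C -[n.+3%:R]natr1 -[n.+2%:R]natr1 -[n.+1%:R]natr1 -[k.+1%:R]natr1.
  rewrite (_ : _ - _ = ((n%:R + 2%:R) * (n%:R + 1) * k%:R) /
     ((k%:R + 1) * (n%:R + k%:R + 2%:R) * (n%:R + k%:R + 3%:R) * F)).
    by rewrite divr_ge0// !mulr_ge0// ?addr_ge0// ltW.
  field; rewrite !gt_eqF// ?ltr_wpDl ?addr_ge0//.
rewrite [leLHS](_ : _ = n`!%:R * x * expR x + n`!%:R * C * (x * psum inv_factS x)); last by ring.
rewrite [leRHS](_ : _ = n`!%:R * x * expR x + n`!%:R * C * expR x); last by rewrite /C; ring.
by rewrite lerD2l ler_wpM2l ?inv_factS_sum_le// ?mulr_ge0.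
Qed.

(** Here the coefficients are at least [n! / j!], except that those of order
    [j < n + 2] are missing; [x] times a missing term is at most [n + 2] times
    the next term of the exponential series. *)
Lemma slope_sum_ge n x : 0 <= x -> n`!%:R * (x - n.+2%:R) * expR x <=
  x * (x ^+ n.+1 * psum (slope_coef n.+1%:R) x).
Proof.
move=> x0.
pose pc k : R := if (k < n.+2)%N then n`!%:R * k`!%:R^-1 else 0.
have e1 : entire (fun k => n`!%:R * k`!%:R^-1 : R) by apply: entireZ; exact: entire_exp.
have e3 : entire pc.
  apply: (entire_le e1) => k; rewrite /pc; case: ifP => _; last by rewrite normr0 divr_ge0.
  by rewrite ger0_norm// divr_ge0.
have e2 : entire (iter n.+1 pshift (slope_coef (n.+1%:R : R))).
  by apply: entire_iter_pshift; exact: es.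
have h1 : n`!%:R * expR x <= x ^+ n.+1 * psum (slope_coef n.+1%:R) x + psum pc x.
  rewrite -psum_iter_pshift// -psumD// -psum_exp -psumZ; last exact: entire_exp.
  apply: le_psum_coef => //; first exact: entireD.
  move=> j; rewrite /pc; case: ltnP => jn; first by rewrite slope_coef_pshift_lt// add0r.
  rewrite -(subnKC jn); set k := (j - n.+2)%N.
  rewrite slope_coef_pshift_ge addr0 ler_wpM2l// lef_pV2 ?posrE ?mulr_gt0//.
  by rewrite -natrM ler_nat -[(n.+2 + k)%N]/((n.+1 + k).+1) factS leq_mul// ltnS leq_addl.
have h2 : x * psum pc x <= n`!%:R * n.+2%:R * expR x.
  rewrite -psum_pshift// -psum_exp -psumZ; last exact: entire_exp.
  apply: le_psum_coef => //; [exact: entire_pshift|by apply: entireZ; exact: entire_exp|].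
  case=> [|k] /=; first by rewrite !mulr_ge0// invr_ge0.
  rewrite /pc; case: ifP => kn; last by rewrite !mulr_ge0// invr_ge0.
  rewrite -mulrA ler_wpM2l// factS natrM invfM mulrA ler_peMl ?invr_ge0//.
  by rewrite ler_pdivlMr// mul1r ler_nat.
have := ler_wpM2l x0 h1; rewrite mulrDr => h3.
rewrite (_ : _ * (x - _) * _ = x * (n`!%:R * expR x) - n`!%:R * n.+2%:R * expR x); last by ring.
by rewrite lerBlDr (le_trans h3)// lerD2l.
Qed.

(** A single term of the exponential series. *)
Lemma pow_le_exp n x : 0 <= x -> x ^+ n <= n`!%:R * expR x.
Proof.
move=> x0; rewrite -psum_exp mulrC -ler_pdivrMr//.
have := @psum_ge_partial R _ x n.+1 entire_exp.
rewrite big_nat_recr//= => H; rewrite mulrC.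
apply: le_trans (H _) => [|k]; last by rewrite mulr_ge0 ?invr_ge0 ?exprn_ge0.
by rewrite lerDr sumr_ge0// => i _; rewrite mulr_ge0 ?invr_ge0 ?exprn_ge0.
Qed.

Definition leading_value n x : R := x ^+ n.+1 / n`!%:R * expR (- x).

Lemma leading_value_gt0 n x : 0 < x -> 0 < leading_value n x.
Proof. by move=> x0; rewrite /leading_value mulr_gt0 ?expR_gt0// divr_gt0// exprn_gt0. Qed.

(** The final estimate, as real arithmetic.  [X] is the expected value, [S0] the
    slope, [G] the quadratic bound and [d] the relative error of [S0 * X]; the
    hypotheses say that [nu] is [1 / S0] up to the relative error
    [2 G / S0^2], which the smallness of [x * X] brings below [d]. *)
Lemma first_zero_arith (S0 G X d nu x : R) :
  0 < X -> 0 < x -> 0 < d -> d <= 16^-1 -> x * X <= d / 8 -> 0 <= G -> G * X <= x ->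
  1 - d <= S0 * X -> S0 * X <= 1 + d ->
  1 <= nu * S0 -> nu * S0 <= 1 + 2 * (G / S0 ^+ 2) -> `|nu / X - 1| <= 4 * d.
Proof.
move=> X0 x0 d0 d16 xX G0 GX sl su nl nu'.
have sX0 : 0 < S0 * X by lra.
have S00 : 0 < S0 by rewrite -(pmulr_lgt0 _ X0).
set s := S0 * X in sl su sX0.
have nE : nu / X = nu * S0 / s by rewrite /s; field; rewrite !gt_eqF.
have gE : G / S0 ^+ 2 = G * X * X / s ^+ 2 by rewrite /s; field; rewrite !gt_eqF.
have gd : 2 * (G / S0 ^+ 2) <= d.
  rewrite gE mulrA ler_pdivrMr ?exprn_gt0//.
  have gx : G * X * X <= x * X by rewrite ler_wpM2r// ltW.
  have s2 : 4^-1 <= s ^+ 2 by rewrite expr2; nra.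
  have : d * 4^-1 <= d * s ^+ 2 by rewrite ler_wpM2l// ltW.
  lra.
rewrite nE ler_norml -lerBlDr opprK lerBlDr; apply/andP; split.
  rewrite addrC ler_pdivlMr//; nra.
rewrite ler_pdivrMr//; nra.
Qed.

(** Lower bound: a zero [nu <= 1] satisfies [1 - nu S0 <= 0].  Upper bound: at
    [s = (1 + 2 e) / S0], with [e = G / S0^2], the quadratic upper bound is
    [e (1 + 2 e)^2 - 2 e <= 0], so that there is a zero below [s]. *)
Lemma first_zero_asymptotics n : exists2 K : R, 0 < K & forall x nu,
  K <= x -> kummer (- nu) n.+1%:R x = 0 ->
  (forall nu', kummer (- nu') n.+1%:R x = 0 -> nu <= nu') ->
  `|nu / leading_value n x - 1| <= K / x.
Proof.
set b : R := n.+1%:R; have b1 : 1 <= b by rewrite ler1n.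
have b0 : 0 < b by exact: lt_le_trans b1.
have [K0 [K00 Ks Kn Kf]] : exists K0 : R, [/\ 1 <= K0, n.+1%:R * n.+3%:R <= K0,
    n.+2%:R <= K0 & 8 * (n.+3)`!%:R <= K0].
  exists (n.+1%:R * n.+3%:R + (n.+2%:R + 8 * (n.+3)`!%:R)); split.
  - apply: (@le_trans _ _ (n.+1 * n.+3)%:R); first by rewrite ler1n.
    by rewrite natrM lerDl addr_ge0// mulr_ge0.
  - by rewrite lerDl addr_ge0// mulr_ge0.
  - by rewrite addrCA lerDl addr_ge0// mulr_ge0.
  - by rewrite addrA lerDr addr_ge0// mulr_ge0.
have K16 : 0 < 16 * K0 by lra.
exists (16 * K0) => //.
move=> x nu Kx Fnu numin.
have x0 : 0 < x by lra.
have x00 := ltW x0.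
set X := leading_value n x; have X0 : 0 < X by exact: leading_value_gt0.
set S0 := psum (slope_coef b) x; set G := psum (inv_poch b) x.
pose d := K0 / x.
have d0 : 0 < d by rewrite divr_gt0//; lra.
have d16 : d <= 16^-1 by rewrite /d ler_pdivrMr//; lra.
have dx : d * x = K0 by rewrite /d mulfVK// gt_eqF.
have E0 : expR x * expR (- x) = 1 by exact: expRxMexpNx_1.
have en0 := expR_gt0 (- x).
(* multiplication by [c] normalizes the bounds on the series, stated in units of [n! e^x] *)
pose c := n`!%:R^-1 * expR (- x).
have XE : X = x ^+ n.+1 * c by rewrite /X /leading_value /c; ring.
have c0 : 0 <= c by rewrite mulr_ge0 ?invr_ge0// ltW.
have norm y : n`!%:R * y * expR x * c = y.
  rewrite [LHS](_ : _ = (n`!%:R / n`!%:R) * y * (expR x * expR (- x))); last by rewrite /c; ring.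
  by rewrite E0 mulr1 divff// mul1r.
have SX : x * (S0 * X) = x * (x ^+ n.+1 * S0) * c by rewrite XE; ring.
have f3 : 0 <= (n.+3)`!%:R :> R by [].
have nn3 : 0 <= n.+1%:R * n.+3%:R :> R by rewrite mulr_ge0.
have n2 : 0 <= n.+2%:R :> R by [].
have su : S0 * X <= 1 + d.
  rewrite -(ler_pM2l x0) mulrDr mulr1 [x * d]mulrC dx SX.
  have := ler_wpM2r c0 (slope_sum_le n x00); rewrite norm => /le_trans; apply.
  by rewrite lerD2l.
have sl : 1 - d <= S0 * X.
  rewrite -(ler_pM2l x0) mulrBr mulr1 [x * d]mulrC dx SX.
  have := ler_wpM2r c0 (slope_sum_ge n x00); rewrite norm; apply: le_trans.
  by rewrite lerD2l lerN2.
have G0 : 0 <= G.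
  by apply: psum_ge0 => // [|k]; [exact: entire_inv_poch|exact: inv_poch_ge0].
have GX : G * X <= x.
  rewrite (_ : G * X = x * (x ^+ n * G * c)); last by rewrite XE exprS; ring.
  rewrite ger_pMr//; have := ler_wpM2r c0 (inv_poch_sum_le n x00).
  by have := norm 1; rewrite mulr1 => ->.
have xX : x * X <= d / 8.
  rewrite -(ler_pM2r x0) [d / 8 * x]mulrAC dx.
  apply: (@le_trans _ _ (x ^+ n.+3 * c)); first by rewrite XE !exprS; lra.
  have := ler_wpM2r c0 (pow_le_exp n.+3 x00).
  move=> /le_trans; apply.
  have -> : (n.+3)`!%:R * expR x * c = (n.+3)`!%:R / n`!%:R.
    rewrite [LHS](_ : _ = ((n.+3)`!%:R / n`!%:R) * (expR x * expR (- x))); last by rewrite /c; ring.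
    by rewrite E0 mulr1.
  apply: (@le_trans _ _ (n.+3)`!%:R); first by rewrite ler_piMr// invf_le1// ler1n fact_gt0.
  by rewrite ler_pdivlMr// mulrC.
have X4 : 4 * X <= 1.
  have x1 : 1 <= x by lra.
  have : X <= x * X by rewrite ler_peMl// ltW.
  lra.
have sX0 : 0 < S0 * X by lra.
have S00 : 0 < S0 by rewrite -(pmulr_lgt0 _ X0).
pose e := G / S0 ^+ 2.
have e0 : 0 <= e by rewrite divr_ge0// exprn_ge0// ltW.
have eE : e * S0 ^+ 2 = G by rewrite /e mulfVK// gt_eqF// exprn_gt0.
have e8 : e <= 8^-1.
  rewrite /e ler_pdivrMr ?exprn_gt0//.
  rewrite -(ler_pM2r (exprn_gt0 2 X0)) -mulrA -exprMn expr2.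
  have : G * X * X <= x * X by rewrite ler_wpM2r// ltW.
  nra.
pose s := (1 + 2 * e) / S0.
have sS : s * S0 = 1 + 2 * e by rewrite /s mulfVK// gt_eqF.
have s0 : 0 <= s by rewrite divr_ge0// ?ltW//; lra.
have s1 : s <= 1.
  rewrite /s ler_pdivrMr// mul1r -(ler_pM2r X0); nra.
have Fs : kummer (- s) b x <= 0.
  have sI : 0 <= s <= 1 by rewrite s0.
  have sG : s ^+ 2 * G = e * (1 + 2 * e) ^+ 2 by rewrite -sS -eE; ring.
  apply: le_trans (kummer_le_quadratic b1 x00 sI) _; rewrite -/S0 -/G sS sG expr2.
  nra.
have sI : 0 <= s <= 1 by rewrite s0.
have [nu' /andP[nu'0 nu's] Fnu'] := kummer_first_zero_exists b1 x00 sI Fs.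
have nus : nu <= s by exact: le_trans (numin _ Fnu') nu's.
have nu0 : 0 < nu by exact: kummer_zero_gt0 b1 x00 Fnu.
have := first_zero_arith X0 x0 d0 d16 xX G0 GX sl su _ _.
have nuI : 0 <= nu <= 1 by rewrite ltW//= (le_trans nus).
have lo : 1 <= nu * S0.
  by have := kummer_ge_linear b1 x00 nuI; rewrite Fnu subr_le0.
have hi : nu * S0 <= 1 + 2 * (G / S0 ^+ 2) by rewrite -/e -sS ler_pM2r.
move=> /(_ _ lo hi) /le_trans; apply.
by rewrite /d mulrA ler_pM2r ?invr_gt0//; lra.
Qed.

End Asymptotics.

(** * The regular radial solution *)

Section Radial.
Context {R : realType}.
Implicit Types (be nu r : R) (n : nat).

Definition gauss be r : R := expR (- (be / 2 * r ^+ 2)).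

(** The regular solution is [r ^+ n * radial0].  As [radial0] depends on [r] through
    [r ^+ 2], its derivative is divisible by [r]: [radial1] and [radial2] are the
    successive quotients, which are again continuous at [0]. *)
Definition radial0 be n nu r : R :=
  gauss be r * kummer (- nu) n.+1%:R (be * r ^+ 2).

Definition kummer_d1 n nu t : R := - nu / n.+1%:R * kummer (- nu + 1) (n.+1%:R + 1) t.
Definition kummer_d2 n nu t : R := - nu / n.+1%:R *
  ((- nu + 1) / (n.+1%:R + 1) * kummer (- nu + 1 + 1) (n.+1%:R + 1 + 1) t).

Definition radial1 be n nu r : R := gauss be r *
  (2 * be * kummer_d1 n nu (be * r ^+ 2) - be * kummer (- nu) n.+1%:R (be * r ^+ 2)).

Definition radial2 be n nu r : R := gauss be r *
  (4 * be ^+ 2 * kummer_d2 n nu (be * r ^+ 2) - 4 * be ^+ 2 * kummer_d1 n nu (be * r ^+ 2)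
   + be ^+ 2 * kummer (- nu) n.+1%:R (be * r ^+ 2)).

Lemma is_derive_scal_sq k r : is_derive r (1 : R) (fun r => k * r ^+ 2) (k * (2 * r)).
Proof.
apply: (is_derive_eq (is_derive_scal k (is_derive_pow 2 r))).
by rewrite expr1.
Qed.

Lemma is_derive_gauss be r :
  is_derive r (1 : R) (gauss be) (- (be * r) * gauss be r).
Proof.
apply: (is_derive_eq (is_derive_comp1 (is_derive_expRN _) (is_derive_scal_sq (be / 2) r))).
by rewrite /gauss; field.
Qed.

Let b1 n : 1 <= n.+1%:R :> R. Proof. by rewrite ler1n. Qed.

Let dk0 n nu t : is_derive t (1 : R) (kummer (- nu) n.+1%:R) (kummer_d1 n nu t).
Proof. exact: is_derive_kummer. Qed.

Let dk1 n nu t : is_derive t (1 : R) (kummer_d1 n nu) (kummer_d2 n nu t).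
Proof. by apply: is_derive_scal; apply: is_derive_kummer; rewrite lerDr. Qed.

Lemma is_derive_radial0 be n nu r :
  is_derive r (1 : R) (radial0 be n nu) (r * radial1 be n nu r).
Proof.
apply: (is_derive_eq (is_derive_mul (is_derive_gauss be r)
  (is_derive_comp1 (dk0 n nu _) (is_derive_scal_sq be r)))).
by rewrite /radial1; ring.
Qed.

Lemma is_derive_radial1 be n nu r :
  is_derive r (1 : R) (radial1 be n nu) (r * radial2 be n nu r).
Proof.
apply: (is_derive_eq (is_derive_mul (is_derive_gauss be r) (is_derive_sub
  (is_derive_scal (2 * be) (is_derive_comp1 (dk1 n nu _) (is_derive_scal_sq be r)))
  (is_derive_scal be (is_derive_comp1 (dk0 n nu _) (is_derive_scal_sq be r)))))).
by rewrite /radial2; ring.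
Qed.

Definition radial_sol be n nu r : R := r ^+ n * radial0 be n nu r.

Definition radial_sol1 be n nu r : R :=
  n%:R * r ^+ n.-1 * radial0 be n nu r + r ^+ n.+1 * radial1 be n nu r.

Definition radial_sol2 be n nu r : R :=
  n%:R * (n.-1%:R * r ^+ n.-2) * radial0 be n nu r +
  n%:R * r ^+ n.-1 * (r * radial1 be n nu r) +
  (n.+1%:R * r ^+ n * radial1 be n nu r + r ^+ n.+1 * (r * radial2 be n nu r)).

Lemma is_derive_radial_sol be n nu r :
  is_derive r (1 : R) (radial_sol be n nu) (radial_sol1 be n nu r).
Proof.
apply: (is_derive_eq (is_derive_mul (is_derive_pow n r) (is_derive_radial0 be n nu r))).
by rewrite /radial_sol1 exprS; ring.
Qed.

Lemma is_derive_radial_sol1 be n nu r :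
  is_derive r (1 : R) (radial_sol1 be n nu) (radial_sol2 be n nu r).
Proof.
apply: (is_derive_eq (is_derive_add
  (is_derive_mul (is_derive_scal n%:R (is_derive_pow n.-1 r)) (is_derive_radial0 be n nu r))
  (is_derive_mul (is_derive_pow n.+1 r) (is_derive_radial1 be n nu r)))).
by rewrite /radial_sol2.
Qed.

(** Kummer's equation read in polar coordinates; [2 * be] and [4 * be * nu] are
    [B / h] and [la / h ^+ 2] for [be = B / (2 h)] and [la = 2 h B nu]. *)
Lemma radial_sol_ode be n nu r : 0 < r ->
  radial_sol2 be n nu r = - radial_sol1 be n nu r / r
   + ((n%:R / r - be * r) ^+ 2 - 2 * be - 4 * be * nu) * radial_sol be n nu r.
Proof.
move=> r0; have rn : r != 0 by rewrite gt_eqF.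
have n0 : n.+1%:R != 0 :> R by rewrite pnatr_eq0.
set t := be * r ^+ 2; set M := kummer (- nu) n.+1%:R t.
have ode : t * kummer_d2 n nu t = - nu * M - (n.+1%:R - t) * kummer_d1 n nu t.
  rewrite /kummer_d2 /kummer_d1 mulrCA kummer_ode_snd// -/M -!natr1; field.
  by rewrite natr1.
have e1 : n%:R * r ^+ n.-1 * r = n%:R * r ^+ n.
  by case: n {n0 M ode} => [|n]; rewrite ?mul0r// [in RHS]exprS /=; ring.
have e2 : n%:R * (n.-1%:R * r ^+ n.-2) * r ^+ 2 = n%:R * (n%:R - 1) * r ^+ n.
  case: n {n0 M ode e1} => [|[|n]]; rewrite ?mul0r ?subrr ?mulr0 ?mul0r//.
  rewrite -[n.+2%:R]natr1 addrK -[n.+2.-1]/n.+1 -[n.+2.-2]/n -[n.+2]addn2 exprD.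
  by ring.
have r20 : r ^+ 2 != 0 by rewrite expf_neq0.
apply: (mulIf r20); rewrite [RHS]mulrDl.
have -> : - radial_sol1 be n nu r / r * r ^+ 2 = - (radial_sol1 be n nu r * r) by field.
have -> : ((n%:R / r - be * r) ^+ 2 - 2 * be - 4 * be * nu) * radial_sol be n nu r * r ^+ 2
   = ((n%:R - be * r ^+ 2) ^+ 2 - 2 * be * r ^+ 2 - 4 * be * nu * r ^+ 2) * radial_sol be n nu r.
  by field.
have -> : radial_sol1 be n nu r * r =
    r ^+ n * (n%:R * radial0 be n nu r + r ^+ 2 * radial1 be n nu r).
  by rewrite /radial_sol1 mulrDl mulrAC e1 [r ^+ n.+1]exprS; ring.
have -> : radial_sol2 be n nu r * r ^+ 2 = r ^+ n * (n%:R * (n%:R - 1) * radial0 be n nu r +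
   (n%:R + n.+1%:R) * r ^+ 2 * radial1 be n nu r + r ^+ 4 * radial2 be n nu r).
  rewrite /radial_sol2 2!mulrDl [_ * radial0 _ _ _ _ * _]mulrAC e2.
  rewrite (_ : n%:R * r ^+ n.-1 * (r * radial1 be n nu r) * r ^+ 2 =
    (n%:R * r ^+ n.-1 * r) * radial1 be n nu r * r ^+ 2); last by ring.
  by rewrite e1 [r ^+ n.+1]exprS; ring.
rewrite /radial_sol; set Y := r ^+ n.
have -> : r ^+ 4 * radial2 be n nu r = gauss be r *
    (r ^+ 2 * be * (4 * (t * kummer_d2 n nu t) - 4 * t * kummer_d1 n nu t + t * M)).
  by rewrite /radial2 -/t -/M /t; ring.
rewrite ode /radial0 /radial1 -/t -/M /t -natr1; ring.
Qed.

Lemma continuous_radial_sol be n nu : continuous (radial_sol be n nu).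
Proof. by move=> r; exact: is_derive_continuous (is_derive_radial_sol be n nu r). Qed.

Lemma continuous_radial_sol1 be n nu : continuous (radial_sol1 be n nu).
Proof. by move=> r; exact: is_derive_continuous (is_derive_radial_sol1 be n nu r). Qed.

Lemma continuous_radial0 be n nu : continuous (radial0 be n nu).
Proof. by move=> r; exact: is_derive_continuous (is_derive_radial0 be n nu r). Qed.

Lemma continuous_radial1 be n nu : continuous (radial1 be n nu).
Proof. by move=> r; exact: is_derive_continuous (is_derive_radial1 be n nu r). Qed.

Lemma continuous_radial2 be n nu : continuous (radial2 be n nu).
Proof.
move=> r.
have b3 : 1 <= n.+1%:R + 1 + 1 :> R by rewrite lerDr addr_ge0.
have dk2 : is_derive (be * r ^+ 2) (1 : R) (kummer_d2 n nu) _ :=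
  is_derive_scal _ (is_derive_scal _ (is_derive_kummer _ _ b3)).
have H := is_derive_mul (is_derive_gauss be r) (is_derive_add
  (is_derive_sub
    (is_derive_scal (4 * be ^+ 2)
      (is_derive_comp1 (g := fun r => be * r ^+ 2) dk2 (is_derive_scal_sq be r)))
    (is_derive_scal (4 * be ^+ 2) (is_derive_comp1 (dk1 n nu _) (is_derive_scal_sq be r))))
  (is_derive_scal (be ^+ 2) (is_derive_comp1 (dk0 n nu _) (is_derive_scal_sq be r)))).
exact: is_derive_continuous H.
Qed.

Lemma continuous_mul (f g : R -> R) : continuous f -> continuous g ->
  continuous (fun x => f x * g x).
Proof. by move=> cf cg x; apply: cvgM; [exact: cf|exact: cg]. Qed.

Lemma continuous_add (f g : R -> R) : continuous f -> continuous g ->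
  continuous (fun x => f x + g x).
Proof. by move=> cf cg x; apply: cvgD; [exact: cf|exact: cg]. Qed.

Lemma continuous_pow n : continuous (fun r : R => r ^+ n).
Proof. exact: exprn_continuous. Qed.

Lemma continuous_idR : continuous (fun r : R => r).
Proof. by move=> r; exact: cvg_id. Qed.

Lemma continuous_cstR (k : R) : continuous (fun _ : R => k).
Proof. by move=> r; exact: cvg_cst. Qed.

Lemma continuous_radial_sol2 be n nu : continuous (radial_sol2 be n nu).
Proof.
have c0 : continuous (radial0 be n nu) by exact: continuous_radial0.
have c1 : continuous (radial1 be n nu) by exact: continuous_radial1.
have c2 : continuous (radial2 be n nu) by exact: continuous_radial2.
have cX k : continuous (fun r : R => r ^+ k) by exact: continuous_pow.
have cI := continuous_idR.
have cC (k : R) : continuous (fun _ : R => k) by exact: continuous_cstR.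
by rewrite /radial_sol2; do !
  [exact: c0|exact: c1|exact: c2|exact: cX|exact: cI|exact: cC
  |apply: continuous_add|apply: continuous_mul].
Qed.

Local Notation mu := (@lebesgue_measure R).

Lemma continuous_L2rdr rho (f g : R -> R) : continuous g ->
  (forall r, 0 < r < rho -> f r = g r) -> L2rdr rho f.
Proof.
move=> cg fg; have mI : measurable (`]0, rho[ : set R) by exact: measurable_itv.
have gf : {in (`]0, rho[%classic : set R), g =1 f}.
  by move=> r; rewrite inE /= in_itv /= => /fg.
split.
  apply: (eq_measurable_fun g) => //.
  by apply: measurable_funTS; exact: continuous_measurable_fun.
apply: (@eq_integrable _ _ _ mu `]0, rho[%classic _ (fun r => (g r ^+ 2 * r)%:E)) => //.
  by move=> r rI; rewrite gf.
apply: (@integrableS _ _ _ mu (`[0, rho]%classic : set R)) => //.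
  by apply: subset_itvW.
apply: continuous_compact_integrable; first exact: segment_compact.
apply: continuous_subspaceT.
rewrite (_ : (fun r => _) = (fun r => g r * g r * r)); last first.
  by apply/funext => r; rewrite expr2.
by apply: continuous_mul; [exact: continuous_mul|exact: continuous_idR].
Qed.

(** Every zero in the parameter is realized by an eigenfunction.  All
    integrability conditions hold because the functions involved extend
    continuously to [[0, rho]]; for [n / r * u] this uses that [u] is divisible
    by [r] when [n > 0]. *)
Lemma radial_sol_eigenspace rho B h n nu : 0 < rho -> 0 < B -> 0 < h ->
  radial_sol (B / (2 * h)) n nu rho = 0 ->
  Pm_eigenspace rho B n%:Z h (2 * h * B * nu) (radial_sol (B / (2 * h)) n nu).
Proof.
move=> rho0 B0 h0 u0; set be := B / (2 * h); set u := radial_sol be n nu.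
have du : derive1 u = radial_sol1 be n nu.
  by apply/funext => r; exact: is_derive1E (is_derive_radial_sol be n nu r).
have cu : continuous u by exact: continuous_radial_sol.
exists (radial_sol2 be n nu); split.
- by move=> r _; exact: is_derive_derivable (is_derive_radial_sol be n nu r).
- move=> a b a0 ab br; rewrite du; split.
    apply: continuous_compact_integrable; first exact: segment_compact.
    by apply: continuous_subspaceT; exact: continuous_radial_sol2.
  move: ab; rewrite le_eqVlt => /predU1P[<-|ab].
    by rewrite subrr set_itv1 Rintegral_set1.
  rewrite /Rintegral (@continuous_FTC2 _ _ (radial_sol1 be n nu)) //.
  + by apply: continuous_subspaceT; exact: continuous_radial_sol2.
  + split.
    * by move=> r _; exact: is_derive_derivable (is_derive_radial_sol1 be n nu r).
    * by apply: cvg_at_right_filter; exact: continuous_radial_sol1.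
    * by apply: cvg_at_left_filter; exact: continuous_radial_sol1.
  + by move=> r _; exact: is_derive1E (is_derive_radial_sol1 be n nu r).
- split.
  + exact: (@continuous_L2rdr _ _ u).
  + rewrite du; apply: (@continuous_L2rdr _ _ (radial_sol1 be n nu)) => //.
    exact: continuous_radial_sol1.
  + apply: (@continuous_L2rdr _ _ (fun r => n%:R * r ^+ n.-1 * radial0 be n nu r)).
      by apply: continuous_mul; [apply: continuous_mul;
        [exact: continuous_cstR|exact: continuous_pow]|exact: continuous_radial0].
    move=> r /andP[r0 _]; rewrite /u /radial_sol.
    case: n {u du cu u0} => [|n]; first by rewrite !mul0r.
    by rewrite exprS /=; field; rewrite gt_eqF.
  + by apply: cvg_at_left_filter; rewrite -u0; exact: cu.
- apply: (@continuous_L2rdr _ _ (fun r => 2 * h * B * nu * u r)) => //.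
  by apply: continuous_mul => //; exact: continuous_cstR.
- apply: aeW => r /andP[r0 _]; rewrite du /Pm_expr radial_sol_ode// -/u.
  rewrite (_ : B * r / (2 * h) = be * r); last by rewrite /be; ring.
  have -> : B = 2 * h * be by rewrite /be mulrC divfK// gt_eqF// mulr_gt0.
  rewrite -[n%:Z%:~R]/(n%:R); field.
  by rewrite gt_eqF.
Qed.

End Radial.

(** * Regularity of eigenfunctions *)

Section Regularity.
Context {R : realType}.
Local Notation mu := (@lebesgue_measure R).

(** The value of the second derivative dictated by [Pm_expr] for an eigenvalue [la]. *)
Definition ode_rhs B (m : int) h la (u u1 : R -> R) r : R :=
  - u1 r / r + ((m%:~R / r - B * r / (2 * h)) ^+ 2 - B / h - la / h ^+ 2) * u r.

Lemma is_derive_cstR (k x : R) : is_derive x (1 : R) (fun _ : R => k) 0.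
Proof. by rewrite (_ : (fun _ => _) = cst k)//; exact: is_derive_cst. Qed.

Lemma continuous_near_eq (f g : R -> R) x : (\near x, g x = f x) ->
  {for x, continuous g} -> {for x, continuous f}.
Proof.
move=> fg; rewrite /prop_for /continuous_at => cg.
by rewrite -(nbhs_singleton fg); apply: cvg_trans cg; apply: near_eq_cvg.
Qed.

Lemma near_itvoo (a b x : R) : a < x < b -> \near x, a < x < b.
Proof.
move=> xab; have : x \in `]a, b[ by rewrite in_itv.
by move=> /near_in_itvoo; apply: filterS => y; rewrite in_itv.
Qed.

Lemma locAC_continuous rho (v w : R -> R) r : locAC_with rho v w ->
  0 < r < rho -> {for r, continuous v}.
Proof.
move=> ac /andP[r0 rr]; pose a := r / 2; pose b := (r + rho) / 2.
have a0 : 0 < a by rewrite /a; lra.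
have ar : a < r by rewrite /a; lra.
have rb : r < b by rewrite /b; lra.
have br : b < rho by rewrite /b; lra.
have ab : a < b by exact: lt_trans rb.
have [wi _] := ac a b a0 (ltW ab) br.
have := parameterized_integral_continuous (ltW ab) wi.
move=> /(continuous_within_itvP _ ab)[+ _ _] => /(_ r).
rewrite in_itv /= ar rb => /(_ isT) cI.
apply: (@continuous_near_eq v (fun x => v a + parameterized_integral mu a x w)); last first.
  by apply: cvgD; [exact: cvg_cst|exact: cI].
have := near_itvoo (introT andP (conj ar rb)).
apply: filterS => x /andP[ax xb].
have [_ E] := ac a x a0 (ltW ax) (lt_trans xb br).
by rewrite /parameterized_integral -E addrC subrK.
Qed.

(** Regularity.  The derivative of [u] is an integral of [w], hence continuous;
    then [w] agrees almost everywhere with the continuous function [ode_rhs],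
    and the fundamental theorem of calculus applies to the latter. *)
Lemma eigenfunction_ode rho B (m : int) h la (u : R -> R) r : 0 < h ->
  Pm_eigenspace rho B m h la u -> 0 < r < rho ->
  is_derive r (1 : R) (derive1 u) (ode_rhs B m h la u (derive1 u) r).
Proof.
move=> h0 [w [du ac _ _ aeE]] /andP[r0 rr].
set v := derive1 u; set g := ode_rhs B m h la u v.
have cg x : 0 < x < rho -> {for x, continuous g}.
  move=> xI; have xn : x != 0 by case/andP: xI => x0 _; rewrite gt_eqF.
  have cv := locAC_continuous ac xI.
  have cu : {for x, continuous u}.
    by apply/differentiable_continuous/derivable1_diffP; exact: du.
  have cV : {for x, continuous (fun r : R => r^-1)} by exact: inv_continuous.
  have cI : {for x, continuous (fun r : R => r)} by exact: cvg_id.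
  rewrite /g /ode_rhs; apply: cvgD.
    by apply: cvgM => //; apply: cvgN.
  apply: cvgM => //; apply: cvgB; last exact: cvg_cst.
  apply: cvgB; last exact: cvg_cst.
  have cq : {for x, continuous (fun r : R => m%:~R / r - B * r / (2 * h))}.
    apply: cvgB; first by apply: cvgM => //; exact: cvg_cst.
    by apply: cvgM; [apply: cvgM => //; exact: cvg_cst|exact: cvg_cst].
  under eq_fun do rewrite expr2.
  by rewrite expr2; apply: cvgM; exact: cq.
pose a := r / 2; pose b := (r + rho) / 2.
have a0 : 0 < a by rewrite /a; lra.
have ar : a < r by rewrite /a; lra.
have rb : r < b by rewrite /b; lra.
have br : b < rho by rewrite /b; lra.
have ab : a < b by exact: lt_trans rb.
have cgab : {within `[a, b], continuous g}.
  apply: continuous_in_subspaceT => x; rewrite inE /= in_itv /= => /andP[ax xb].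
  by apply: cg; rewrite (lt_le_trans a0 ax) (le_lt_trans xb br).
have gi : mu.-integrable `[a, b] (EFin \o g).
  by apply: continuous_compact_integrable => //; exact: segment_compact.
have intE x : a < x < b -> \int[mu]_(t in `[a, x]) w t = \int[mu]_(t in `[a, x]) g t.
  move=> /andP[ax xb]; have [wi _] := ac a x a0 (ltW ax) (lt_trans xb br).
  rewrite /Rintegral; congr fine; apply: ae_eq_integral => //.
  - by case/integrableP: wi.
  - have : mu.-integrable `[a, x] (EFin \o g).
      by apply: integrableS gi => //; apply: subset_itvl; rewrite bnd_simp ltW.
    by case/integrableP.
  - apply: (@filterS _ _ (ae_filter_ringOfSetsType mu) _ _ _ aeE) => t + /=.
    rewrite in_itv /= => E /andP[at_ tx].
    have t0 : 0 < t by exact: lt_le_trans at_.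
    have tI : 0 < t < rho by rewrite t0 (le_lt_trans tx) // (lt_trans xb).
    congr EFin; move: (E tI); rewrite /Pm_expr /g /ode_rhs -/v => {}E.
    have hn : h != 0 by rewrite gt_eqF.
    have tn : t != 0 by rewrite gt_eqF.
    rewrite [RHS](_ : _ = - v t / t + ((m%:~R / t - B * t / (2 * h)) ^+ 2 - B / h) * u t
      - (la * u t) / h ^+ 2); last by ring.
    by rewrite E; field; rewrite hn tn.
have [dF FE] := @continuous_FTC1_closed R g a r b rb gi ar (cg r (introT andP (conj r0 rr))).
have isF : is_derive r (1 : R) (fun x => v a + \int[mu]_(t in `[a, x]) g t) (0 + g r).
  apply: is_derive_add.
  by rewrite -FE derive1E; exact/derivableP.
rewrite add0r in isF; apply: near_eq_is_derive isF.
have := near_itvoo (introT andP (conj ar rb)).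
apply: filterS => x /andP[ax xb].
have [_ E] := ac a x a0 (ltW ax) (lt_trans xb br).
by rewrite -intE ?ax// -E addrC subrK.
Qed.

End Regularity.

(** * Uniqueness of the regular solution *)

Section Uniqueness.
Context {R : realType}.
Local Notation mu := (@lebesgue_measure R).
Implicit Types (a b x y r t : R).

Lemma continuous_bounded_itv (f : R -> R) a b : a <= b ->
  {within `[a, b], continuous f} ->
  exists2 M, 0 <= M & forall x, a <= x <= b -> `|f x| <= M.
Proof.
move=> ab cf.
have cn : {within `[a, b], continuous (fun x => `|f x|)}.
  by move=> x; apply: cvg_norm; exact: cf.
have [c _ cmax] := EVT_max ab cn.
by exists `|f c| => // x xab; apply: cmax; rewrite in_itv.
Qed.

Lemma derive0_const (f : R -> R) a b x y :
  (forall t, a < t < b -> is_derive t (1 : R) f 0) ->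
  a < x < b -> a < y < b -> f x = f y.
Proof.
move=> df; wlog xy : x y / x <= y => [H xab yab|].
  by have [xy|/ltW yx] := leP x y; [exact: H|apply/esym; exact: H].
move=> /andP[ax xb] /andP[ay yb].
have I t : x <= t <= y -> a < t < b.
  by move=> /andP[xt ty]; rewrite (lt_le_trans ax xt) (le_lt_trans ty yb).
have [||c _] := @MVT_segment R f (fun _ => 0) x y xy.
- move=> t; rewrite in_itv /= => /andP[xt ty]; apply: df; apply: I.
  by rewrite (ltW xt) (ltW ty).
- apply: continuous_in_subspaceT => t; rewrite inE /= in_itv /= => /I tI.
  exact: is_derive_continuous (df t tI).
by rewrite mul0r => /eqP; rewrite subr_eq0 => /eqP.
Qed.

Lemma is_derive_exp_scal (k x : R) :
  is_derive x (1 : R) (fun t => expR (k * t)) (k * expR (k * x)).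
Proof.
apply: (is_derive_eq (is_derive_comp1 (is_derive_expR _) (is_derive_scal k (is_derive_id x 1)))).
by rewrite mulr1 mulrC.
Qed.

(** [E x * expR (L * x)] is nondecreasing and [E x * expR (- L * x)]
    nonincreasing: the first settles the points to the left of [r0], the second
    those to the right. *)
Lemma gronwall_zero (E dE : R -> R) a b L r0 r :
  (forall x, a < x < b -> is_derive x (1 : R) E (dE x)) ->
  (forall x, a < x < b -> 0 <= E x) ->
  (forall x, a < x < b -> `|dE x| <= L * E x) ->
  a < r0 < b -> a < r < b -> E r0 = 0 -> E r = 0.
Proof.
move=> dEx E0 dL r0I rI Er0; apply/eqP; rewrite eq_le E0// andbT.
pose F k x := E x * expR (k * x).
have dF k x : a < x < b -> is_derive x (1 : R) (F k) ((dE x + k * E x) * expR (k * x)).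
  move=> xI; apply: (is_derive_eq (is_derive_mul (dEx x xI) (is_derive_exp_scal k x))).
  by ring.
have mvt k x y : a < x < b -> a < y < b -> x <= y -> exists2 c, a < c < b &
    F k y - F k x = (dE c + k * E c) * expR (k * c) * (y - x).
  move=> /andP[ax _] /andP[_ yb] xy.
  have I t : x <= t <= y -> a < t < b.
    by move=> /andP[xt ty]; rewrite (lt_le_trans ax xt) (le_lt_trans ty yb).
  have [||c cI ->] := @MVT_segment R (F k) (fun c => (dE c + k * E c) * expR (k * c)) x y xy.
  - move=> t; rewrite in_itv /= => /andP[xt ty]; apply: dF; apply: I.
    by rewrite (ltW xt) (ltW ty).
  - apply: continuous_in_subspaceT => t; rewrite inE /= in_itv /= => /I tI.
    exact: is_derive_continuous (dF k t tI).
  by exists c => //; apply: I; move: cI; rewrite in_itv.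
have Fr0 k : F k r0 = 0 by rewrite /F Er0 mul0r.
suff [k Fk] : exists k, F k r <= 0.
  by rewrite -(pmulr_lle0 _ (expR_gt0 (k * r))).
have [r0r|/ltW rr0] := leP r0 r.
  exists (- L); have [c cI] := mvt (- L) _ _ r0I rI r0r; rewrite Fr0 subr0 => ->.
  rewrite mulr_le0_ge0 ?subr_ge0// mulr_le0_ge0 ?expR_ge0//.
  by have := dL c cI; rewrite ler_norml => /andP[_]; lra.
exists L; have [c cI] := mvt L _ _ rI r0I rr0; rewrite Fr0 sub0r => /eqP.
rewrite eqr_oppLR => /eqP ->; rewrite oppr_le0.
rewrite mulr_ge0 ?subr_ge0// mulr_ge0 ?expR_ge0//.
by have := dL c cI; rewrite ler_norml => /andP[+ _]; lra.
Qed.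

(** Gronwall's lemma for the energy [z^2 + z'^2], on a compact interval containing
    both points, where [1 / x] and [Q] are bounded. *)
Lemma ode_unique (z z1 Q : R -> R) rho r0 r :
  (forall x, 0 < x < rho -> is_derive x (1 : R) z (z1 x)) ->
  (forall x, 0 < x < rho -> is_derive x (1 : R) z1 (- z1 x / x + Q x * z x)) ->
  (forall x, 0 < x < rho -> {for x, continuous Q}) ->
  0 < r0 < rho -> 0 < r < rho -> z r0 = 0 -> z1 r0 = 0 -> z r = 0.
Proof.
move=> dz dz1 cQ /andP[r00 r0r] /andP[rp rr] z0 z10.
pose a := Num.min r0 r / 2; pose b := (Num.max r0 r + rho) / 2.
have m0 : 0 < Num.min r0 r by rewrite lt_min r00 rp.
have mr0 : Num.min r0 r <= r0 by rewrite ge_min lexx.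
have mr : Num.min r0 r <= r by rewrite ge_min lexx orbT.
have Mr : Num.max r0 r < rho by rewrite gt_max r0r rr.
have Mr0 : r0 <= Num.max r0 r by rewrite le_max lexx.
have Mrr : r <= Num.max r0 r by rewrite le_max lexx orbT.
have a0 : 0 < a by rewrite /a; lra.
have br : b < rho by rewrite /b; lra.
have ar0 : a < r0 by rewrite /a; lra.
have ar : a < r by rewrite /a; lra.
have r0b : r0 < b by rewrite /b; lra.
have rb : r < b by rewrite /b; lra.
have ab : a <= b by exact: ltW (lt_trans ar rb).
have I x : a <= x <= b -> 0 < x < rho.
  by move=> /andP[ax xb]; rewrite (lt_le_trans a0 ax) (le_lt_trans xb br).
have J x : a < x < b -> 0 < x < rho by move=> /andP[/ltW ax /ltW xb]; apply: I; rewrite ax.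
have [|K K0 QK] := @continuous_bounded_itv Q a b ab.
  by apply: continuous_in_subspaceT => t; rewrite inE /= in_itv /= => /I; exact: cQ.
pose E x := z x * z x + z1 x * z1 x.
pose dE x := (z1 x * z x + z x * z1 x) +
  ((- z1 x / x + Q x * z x) * z1 x + z1 x * (- z1 x / x + Q x * z x)).
have Er : E r = 0.
  apply: (@gronwall_zero E dE a b (1 + K + 2 / a) r0 r).
  - move=> x /J xI; apply: is_derive_add; apply: is_derive_mul; by [exact: dz|exact: dz1].
  - by move=> x _; rewrite /E -!expr2 addr_ge0// sqr_ge0.
  - move=> x xI; have xJ := J x xI; have /andP[x0 _] := xJ.
    have qx : `|Q x| <= K by apply: QK; case/andP: xI => /ltW -> /ltW ->.
    have ix : x^-1 <= a^-1 by rewrite lef_pV2 ?posrE//; case/andP: xI => /ltW.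
    have ix0 : 0 < x^-1 by rewrite invr_gt0.
    rewrite (_ : dE x = 2 * (1 + Q x) * (z x * z1 x) - 2 * x^-1 * (z1 x * z1 x)); last first.
      by rewrite /dE; ring.
    apply: le_trans (ler_normB _ _) _; rewrite [leRHS]mulrDl lerD//.
      rewrite normrM; apply: (@le_trans _ _ (2 * (1 + K) * `|z x * z1 x|)).
        rewrite ler_wpM2r// normrM ger0_norm// ler_wpM2l//.
        by apply: le_trans (ler_normD _ _) _; rewrite normr1 lerD2l.
      rewrite [2 * _]mulrC -mulrA ler_wpM2l ?addr_ge0// normrM /E.
      have e1 : z x * z x = `|z x| * `|z x| by rewrite -normrM ger0_norm// -expr2 sqr_ge0.
      have e2 : z1 x * z1 x = `|z1 x| * `|z1 x| by rewrite -normrM ger0_norm// -expr2 sqr_ge0.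
      rewrite e1 e2; have := sqr_ge0 (`|z x| - `|z1 x|); rewrite expr2; lra.
    have s0 : 0 <= z1 x * z1 x by rewrite -expr2 sqr_ge0.
    have s1 : 0 <= z x * z x by rewrite -expr2 sqr_ge0.
    have i2 : 0 <= 2 * x^-1 by rewrite mulr_ge0// ltW.
    rewrite ger0_norm; last exact: mulr_ge0.
    rewrite ler_pM//.
    + by rewrite ler_wpM2l.
    + by rewrite /E lerDr.
  - by rewrite ar0 r0b.
  - by rewrite ar rb.
  - by rewrite /E z0 z10 !mul0r addr0.
have : z r ^+ 2 <= 0.
  by rewrite -Er /E expr2 lerDl -expr2 sqr_ge0.
move=> zr; by apply/eqP; rewrite -sqrf_eq0 eq_le zr sqr_ge0.
Qed.

(** Its integral over [[a, c]] is [ln c - ln a], which is unbounded as [a] tends to [0]. *)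
Lemma inv_not_integrable rho : 0 < rho ->
  ~ mu.-integrable `]0, rho[ (fun r => (r^-1)%:E).
Proof.
move=> rho0 /integrableP[mf fin].
pose I := fine (\int[mu]_(x in `]0%R, rho[) `|(x^-1)%:E|)%E.
have IE : (\int[mu]_(x in `]0%R, rho[) `|(x^-1)%:E|)%E = I%:E.
  by rewrite fineK// ge0_fin_numE//; apply: integral_ge0.
have I0 : 0 <= I by rewrite fine_ge0//; apply: integral_ge0.
pose c := rho / 2; have c0 : 0 < c by rewrite divr_gt0.
have crho : c < rho by rewrite /c; lra.
(* chosen such that [ln c - ln a] exceeds the total integral [I] by one *)
pose a := c * expR (- (I + 1)).
have a0 : 0 < a by rewrite mulr_gt0// expR_gt0.
have ac : a < c.
  by rewrite /a gtr_pMr// -expR0 ltr_expR oppr_lt0 ltr_wpDl.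
have dln x : 0 < x -> is_derive x (1 : R) (@ln R) x^-1 by move=> x0; exact: is_derive1_ln.
have E : (\int[mu]_(x in `[a, c]) (x^-1)%:E)%E = (ln c - ln a)%:E.
  rewrite (@continuous_FTC2 R (fun x => x^-1) (@ln R))//.
  - apply: continuous_in_subspaceT => x; rewrite inE /= in_itv /= => /andP[ax _].
    by apply: inv_continuous; rewrite gt_eqF// (lt_le_trans a0).
  - split.
    + move=> x; rewrite in_itv /= => /andP[ax _].
      exact: is_derive_derivable (dln x (lt_trans a0 ax)).
    + by apply: cvg_at_right_filter; exact: is_derive_continuous (dln a a0).
    + by apply: cvg_at_left_filter; exact: is_derive_continuous (dln c c0).
  - move=> x; rewrite in_itv /= => /andP[ax _].
    exact: is_derive1E (dln x (lt_trans a0 ax)).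
have : ((ln c - ln a)%:E <= I%:E)%E.
  rewrite -E -IE; apply: (@le_trans _ _ (\int[mu]_(x in `[a, c]) `|(x^-1)%:E|)%E).
    have -> : (\int[mu]_(x in `[a, c]) (x^-1)%:E = \int[mu]_(x in `[a, c]) `|(x^-1)%:E|)%E.
      apply: eq_integral => x; rewrite inE /= in_itv /= => /andP[ax _].
      by rewrite ger0_norm// invr_ge0 (le_trans (ltW a0)).
    exact: lexx.
  apply: ge0_subset_integral => //.
  - by apply: measurableT_comp.
  - move=> x /=; rewrite !in_itv /= => /andP[ax xc].
    by rewrite (lt_le_trans a0 ax) (le_lt_trans xc).
have -> : ln a = ln c - (I + 1) by rewrite /a lnM ?posrE ?expR_gt0// expRK.
by rewrite lee_fin; lra.
Qed.

(** A nonzero multiple of [1 / r] cannot be dominated by an integrable function. *)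
Lemma L2rdr_inv_bound rho (f1 f2 f3 : R -> R) (K C : R) : 0 < rho ->
  L2rdr rho f1 -> L2rdr rho f2 -> L2rdr rho f3 ->
  (forall r, 0 < r < rho -> C ^+ 2 / r <= K * (f1 r ^+ 2 * r + f2 r ^+ 2 * r + f3 r ^+ 2 * r)) ->
  C = 0.
Proof.
move=> rho0 [_ i1] [_ i2] [_ i3] le; apply/eqP/negPn/negP => C0.
have C20 : 0 < C ^+ 2 by rewrite exprn_even_gt0.
have mI : measurable (`]0, rho[%classic : set (measurableTypeR R)) by exact: measurable_itv.
apply: (inv_not_integrable rho0).
have i := integrableZl mI (K / C ^+ 2) (integrableD mI (integrableD mI i1 i2) i3).
apply: le_integrable i => //.
  apply/measurable_EFinP; apply: open_continuous_measurable_fun.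
    exact: interval_open.
  move=> x; rewrite inE /= in_itv /= => /andP[x0 _].
  by apply: inv_continuous; rewrite gt_eqF.
move=> x; rewrite /= in_itv /= => xI; have /andP[x0 _] := xI.
rewrite lee_fin ger0_norm ?invr_ge0 ?(ltW x0)//.
apply: le_trans (ler_norm _); rewrite mulrAC ler_pdivlMr// mulrC.
exact: le.
Qed.

(** The regularity condition at the origin at work.  The Wronskian
    [C = r (u p' - u' p)] with the regular solution [p = r^n * radial0] is
    constant; since [p] is [O(r^n)] and [p'] is [O(n r^(n-1) + r^(n+1))], it is
    bounded by a constant times [r] times the integrand of the energy norm, so
    [C^2 / r] is integrable. *)
Lemma radial_wronskian_zero be n nu rho (u u1 : R -> R) : 0 < rho ->
  L2rdr rho u -> L2rdr rho u1 -> L2rdr rho (fun r => n%:R / r * u r) ->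
  (forall x, 0 < x < rho -> is_derive x (1 : R) u (u1 x)) ->
  (forall x, 0 < x < rho -> is_derive x (1 : R) u1 (- u1 x / x +
     ((n%:R / x - be * x) ^+ 2 - 2 * be - 4 * be * nu) * u x)) ->
  forall x, 0 < x < rho -> u x * radial_sol1 be n nu x = u1 x * radial_sol be n nu x.
Proof.
move=> rho0 Lu Lu1 Lmu du du1.
set p := radial_sol be n nu; set p1 := radial_sol1 be n nu.
pose W x := x * (u x * p1 x - u1 x * p x).
have dW x : 0 < x < rho -> is_derive x (1 : R) W 0.
  move=> xI; have /andP[x0 _] := xI.
  apply: (is_derive_eq (is_derive_mul (is_derive_id x 1) (is_derive_sub
    (is_derive_mul (du x xI) (is_derive_radial_sol1 be n nu x))
    (is_derive_mul (du1 x xI) (is_derive_radial_sol be n nu x))))).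
  rewrite radial_sol_ode// -/p -/p1; field.
  by rewrite gt_eqF.
pose c := rho / 2; have cI : 0 < c < rho by apply/andP; rewrite /c; split; lra.
have WE x : 0 < x < rho -> W x = W c by move=> xI; exact: derive0_const dW xI cI.
suff Wc : W c = 0.
  move=> x xI; have /andP[x0 _] := xI; have := WE x xI; rewrite Wc /W => /eqP.
  by rewrite mulf_eq0 (gt_eqF x0) /= subr_eq0 => /eqP.
have [|M0 M00 M0P] := @continuous_bounded_itv (radial0 be n nu) 0 rho (ltW rho0).
  by apply: continuous_subspaceT; exact: continuous_radial0.
have [|M1 M10 M1P] := @continuous_bounded_itv (radial1 be n nu) 0 rho (ltW rho0).
  by apply: continuous_subspaceT; exact: continuous_radial1.
pose M := M0 + M1.
(* [3] from the square of a sum of three terms, [1 + rho ^+ 2] from bounding [x ^+ 2] and [1] *)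
pose K := 3 * (rho ^+ n * M) ^+ 2 * (1 + rho ^+ 2).
apply: (L2rdr_inv_bound (K := K) rho0 Lu Lmu Lu1) => x xI.
have /andP[x0 xr] := xI; have x00 := ltW x0.
rewrite -(WE x xI).
set q := n%:R / x * u x.
have xI' : 0 <= x <= rho by rewrite x00 ltW.
have WF : W x = x ^+ n * (q * x * radial0 be n nu x + x ^+ 2 * u x * radial1 be n nu x
    - x * u1 x * radial0 be n nu x).
  rewrite /W /p1 /p /radial_sol1 /radial_sol /q.
  case: (n) => [|k]; first by rewrite !mul0r expr1; ring.
  rewrite -[k.+1.-1]/k !(exprS x); field.
  by rewrite gt_eqF.
pose T := `|q| + x * `|u x| + `|u1 x|.
have T0 : 0 <= T by rewrite !addr_ge0// mulr_ge0.
have WT : `|W x| <= rho ^+ n * M * (x * T).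
  have xn : `|x ^+ n| <= rho ^+ n.
    by rewrite normrX (ger0_norm x00) lerXn2r ?nnegrE// ltW.
  rewrite WF normrM -[leRHS]mulrA; apply: ler_pM => //.
  have a0 : `|radial0 be n nu x| <= M by rewrite (le_trans (M0P x xI'))// lerDl.
  have a1 : `|radial1 be n nu x| <= M by rewrite (le_trans (M1P x xI'))// lerDr.
  move: (radial0 be n nu x) (radial1 be n nu x) a0 a1 => A0 A1 a0 a1.
  apply: le_trans (ler_normB _ _) _.
  rewrite (_ : M * _ = `|q| * x * M + x ^+ 2 * `|u x| * M + x * `|u1 x| * M); last first.
    by rewrite /T; ring.
  apply: lerD; last first.
    by rewrite !normrM (ger0_norm x00) ler_wpM2l ?mulr_ge0//.
  apply: le_trans (ler_normD _ _) _; apply: lerD.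
    by rewrite !normrM (ger0_norm x00) ler_wpM2l ?mulr_ge0//.
  by rewrite expr2 !normrM (ger0_norm x00) ler_wpM2l ?mulr_ge0 ?exprn_ge0//.
have W2 : W x ^+ 2 <= (rho ^+ n * M) ^+ 2 * (x ^+ 2 * T ^+ 2).
  have := ler_pM (normr_ge0 _) (normr_ge0 _) WT WT.
  rewrite -normrM ger0_norm -?expr2 ?sqr_ge0// => /le_trans; apply.
  by rewrite !exprMn.
rewrite ler_pdivrMr//; apply: le_trans W2 _; rewrite /K.
have TT : T ^+ 2 <= 3 * (1 + rho ^+ 2) * (u x ^+ 2 + q ^+ 2 + u1 x ^+ 2).
  have e2 : x ^+ 2 <= rho ^+ 2 by rewrite lerXn2r// ?nnegrE ltW.
  have s (y : R) : y ^+ 2 = `|y| ^+ 2 by rewrite real_normK// num_real.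
  rewrite (s (u x)) (s q) (s (u1 x)) /T.
  move: (normr_ge0 (u x)) (normr_ge0 q) (normr_ge0 (u1 x)).
  move: `|u x| `|q| `|u1 x| => U Q V U0 Q0 V0.
  apply: (@le_trans _ _ (3 * (Q ^+ 2 + (x * U) ^+ 2 + V ^+ 2))).
    have := sqr_ge0 (Q - x * U); have := sqr_ge0 (Q - V); have := sqr_ge0 (x * U - V).
    rewrite !expr2; nra.
  rewrite -mulrA ler_wpM2l// exprMn.
  have : x ^+ 2 * U ^+ 2 <= rho ^+ 2 * U ^+ 2 by rewrite ler_wpM2r// exprn_ge0.
  have := sqr_ge0 Q; have := sqr_ge0 U; have := sqr_ge0 V; have := sqr_ge0 rho.
  move: (rho ^+ 2) (Q ^+ 2) (V ^+ 2) (U ^+ 2) => r2 Q2 V2 U2 h1 h2 h3 h4.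
  have : 0 <= r2 * Q2 by rewrite mulr_ge0.
  have : 0 <= r2 * V2 by rewrite mulr_ge0.
  lra.
rewrite [leRHS](_ : _ = (rho ^+ n * M) ^+ 2 * (x ^+ 2 * (3 * (1 + rho ^+ 2) *
   (u x ^+ 2 + q ^+ 2 + u1 x ^+ 2)))); last by ring.
by rewrite ler_wpM2l ?sqr_ge0// ler_wpM2l ?sqr_ge0.
Qed.

End Uniqueness.

(** * The spectrum *)

Section Spectrum.
Context {R : realType}.
Local Notation mu := (@lebesgue_measure R).
Implicit Types (rho B h la nu : R) (n : nat) (u : R -> R).

Lemma radial_sol_eq0 be n nu rho : 0 < rho ->
  (radial_sol be n nu rho == 0) = (kummer (- nu) n.+1%:R (be * rho ^+ 2) == 0).
Proof.
move=> rho0; rewrite /radial_sol /radial0 /gauss !mulf_eq0 expR_eq0.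
by rewrite expf_eq0 (gt_eqF rho0) andbF.
Qed.

Lemma radial_sol_nonzero be n nu rho : 0 < be -> 0 < rho ->
  exists2 r, 0 < r < rho & radial_sol be n nu r != 0.
Proof.
move=> be0 rho0.
have T0 : 0 < be * rho ^+ 2 by rewrite mulr_gt0// exprn_gt0.
have n1 : 1 <= n.+1%:R :> R by rewrite ler1n.
have [x /andP[x0 xT] fx] := kummer_nonzero_in nu n1 (lexx 0) T0.
have q0 : 0 < x / be by rewrite divr_gt0.
exists (Num.sqrt (x / be)).
  rewrite sqrtr_gt0 q0 /= -(ltr_pXn2r (n := 2)) ?nnegrE ?sqrtr_ge0 ?ltW//.
  by rewrite sqr_sqrtr ?ltW// ltr_pdivrMr// mulrC.
rewrite radial_sol_eq0 ?sqrtr_gt0// sqr_sqrtr ?ltW// mulrC divfK//.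
by rewrite gt_eqF.
Qed.

(** The Wronskian with the regular solution being zero, the multiple of it that
    agrees with [u] at one point has there the derivative of [u] as well. *)
Lemma eigenfunction_radial_sol rho B h n la u :
  0 < rho -> 0 < B -> 0 < h -> Pm_eigenspace rho B n%:Z h la u ->
  exists c, forall r, 0 < r < rho ->
    u r = c * radial_sol (B / (2 * h)) n (la / (2 * h * B)) r.
Proof.
move=> rho0 B0 h0 eu.
have hn : h != 0 by rewrite gt_eqF.
have Bn : B != 0 by rewrite gt_eqF.
set be := B / (2 * h); set nu := la / (2 * h * B).
have be0 : 0 < be by rewrite divr_gt0// mulr_gt0.
have du x : 0 < x < rho -> is_derive x (1 : R) u (derive1 u x).
  by move=> xI; case: eu => w [d _ _ _ _]; rewrite derive1E; apply/derivableP; exact: d.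
have du1 x : 0 < x < rho -> is_derive x (1 : R) (derive1 u) (- derive1 u x / x +
     ((n%:R / x - be * x) ^+ 2 - 2 * be - 4 * be * nu) * u x).
  move=> xI; apply: (is_derive_eq (eigenfunction_ode h0 eu xI)).
  rewrite /ode_rhs -[n%:Z%:~R]/(n%:R) (_ : B * x / (2 * h) = be * x); last by rewrite /be; ring.
  congr (_ + (_ - _ - _) * _); rewrite /be /nu; field.
    by [].
  by rewrite hn Bn.
have [Lu Lu1 Lmu _] : radial_H10 rho n%:Z u by case: eu => w [].
have W := radial_wronskian_zero rho0 Lu Lu1 Lmu du du1.
have [r0 r0I p0] := radial_sol_nonzero n nu be0 rho0.
exists (u r0 / radial_sol be n nu r0) => r rI; apply/eqP; rewrite -subr_eq0; apply/eqP.
set c := u r0 / radial_sol be n nu r0.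
pose Q x := (n%:R / x - be * x) ^+ 2 - 2 * be - 4 * be * nu.
apply: (@ode_unique R (fun x => u x - c * radial_sol be n nu x)
  (fun x => derive1 u x - c * radial_sol1 be n nu x) Q rho r0 r) => //.
- move=> x xI; apply: is_derive_sub; first exact: du.
  by apply: is_derive_scal; exact: is_derive_radial_sol.
- move=> x xI; have /andP[x0 _] := xI.
  apply: (is_derive_eq (is_derive_sub (du1 x xI)
    (is_derive_scal c (is_derive_radial_sol1 be n nu x)))).
  by rewrite radial_sol_ode// /Q; ring.
- move=> x /andP[x0 _].
  have xn : x != 0 by rewrite gt_eqF.
  have dinv : is_derive x (1 : R) (fun r : R => r^-1) _ := is_deriveV xn (is_derive_id x 1).
  have dq := is_derive_sub (is_derive_scal n%:R dinv) (is_derive_scal be (is_derive_id x 1)).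
  have -> : Q = (fun t => (n%:R * t^-1 - be * t) * (n%:R * t^-1 - be * t) -
      (2 * be + 4 * be * nu)) by apply/funext => t; rewrite /Q; ring.
  exact: is_derive_continuous (is_derive_sub (is_derive_mul dq dq)
     (is_derive_cstR (2 * be + 4 * be * nu) x)).
- by rewrite /c divfK// subrr.
- by rewrite /c mulrAC W// mulfK// subrr.
Qed.

Lemma eigenvalue_kummer rho B h n la u :
  0 < rho -> 0 < B -> 0 < h -> Pm_eigenspace rho B n%:Z h la u ->
  (exists2 r, 0 < r < rho & u r != 0) ->
  kummer (- (la / (2 * h * B))) n.+1%:R (B * rho ^+ 2 / (2 * h)) = 0.
Proof.
move=> rho0 B0 h0 eu [r rI ur].
have [c cE] := eigenfunction_radial_sol rho0 B0 h0 eu.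
set be := B / (2 * h) in cE; set nu := la / (2 * h * B) in cE *.
have c0 : c != 0 by apply: contraNneq ur => c0; rewrite cE// c0 mul0r.
suff p0 : radial_sol be n nu rho = 0.
  apply/eqP; have : radial_sol be n nu rho == 0 by rewrite p0.
  by rewrite radial_sol_eq0// mulrAC.
have [_ _ _ u0] : radial_H10 rho n%:Z u by case: eu => w [].
have cp : (c * radial_sol be n nu t) @[t --> rho^'-] --> c * radial_sol be n nu rho.
  by apply: cvg_at_left_filter; apply: cvgMr; exact: continuous_radial_sol.
have E : \forall t \near rho^'-, u t = c * radial_sol be n nu t.
  apply: filterS2 (nbhs_left_gt rho0) (nbhs_left_lt rho) => t t0 tr.
  by apply: cE; rewrite t0 tr.
have : (c * radial_sol be n nu t) @[t --> rho^'-] --> (0 : R).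
  by apply: cvg_trans u0; apply: near_eq_cvg; apply: filterS E => t ->.
move=> /(cvg_unique _ cp) => /(_ (@norm_hausdorff _ _)) /eqP.
by rewrite mulf_eq0 (negbTE c0) /= => /eqP.
Qed.

Lemma L2rdr_scal rho (k : R) (f : R -> R) : L2rdr rho f -> L2rdr rho (fun r => k * f r).
Proof.
move=> [mf fi]; split; first by apply: measurable_funM => //; exact: measurable_cst.
have mI : measurable (`]0, rho[%classic : set (measurableTypeR R)) by exact: measurable_itv.
apply: (@eq_integrable _ _ _ mu `]0, rho[%classic _
  (fun r => ((k ^+ 2)%:E * (f r ^+ 2 * r)%:E)%E)) => //.
  by move=> r _; rewrite -EFinM exprMn mulrA.
exact: integrableZl.
Qed.

(** Since [(- n / r - b r)^2 = (n / r - b r)^2 + 4 n b], the two operators differ by a constant. *)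
Lemma eigenspace_opp rho B h n la u : 0 < h ->
  Pm_eigenspace rho B (- n%:Z) h la u ->
  Pm_eigenspace rho B n%:Z h (la - 2 * n%:R * h * B) u.
Proof.
move=> h0 [w [du ac [Lu Lu1 Lmu u0] Lf ae]].
have hn : h != 0 by rewrite gt_eqF.
exists w; split => //.
- split=> //.
  have -> : (fun r => (n%:Z)%:~R / r * u r) = (fun r => - 1 * ((- n%:Z)%:~R / r * u r)).
    by apply/funext => r; rewrite rmorphN /=; ring.
  exact: L2rdr_scal.
- exact: L2rdr_scal.
apply: (@filterS _ _ (ae_filter_ringOfSetsType mu) _ _ _ ae) => r E rI.
have /andP[r0 _] := rI; have rn : r != 0 by rewrite gt_eqF.
rewrite mulrBl (E rI) /Pm_expr rmorphN /=; field.
by rewrite hn rn.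
Qed.

Lemma free_nonzero rho (e : nat -> R -> R) k :
  (forall n (c : 'I_n -> R),
     (forall r, 0 < r < rho -> \sum_(k < n) c k * e k r = 0) -> forall k, c k = 0) ->
  exists2 r, 0 < r < rho & e k r != 0.
Proof.
move=> free; apply: contrapT => H.
have ek r : 0 < r < rho -> e k r = 0.
  by move=> rI; apply/eqP/negPn/negP => er; apply: H; exists r.
pose c (i : 'I_k.+1) : R := (i == ord_max)%:R.
have /eqP : c ord_max = 0.
  apply: free => r rI; rewrite big_ord_recr /= /c eqxx mul1r ek// addr0 big1// => i _.
  rewrite (_ : _ == _ = false) ?mul0r//.
  by apply/negbTE; rewrite -val_eqE /= ltn_eqF.
by rewrite /c eqxx oner_eq0.
Qed.

Lemma free_not_proportional rho (e : nat -> R -> R) k (p : R -> R) (a b : R) :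
  (forall n (c : 'I_n -> R),
     (forall r, 0 < r < rho -> \sum_(k < n) c k * e k r = 0) -> forall k, c k = 0) ->
  (forall r, 0 < r < rho -> e k r = a * p r) ->
  (forall r, 0 < r < rho -> e k.+1 r = b * p r) -> False.
Proof.
move=> free ea eb.
pose c (i : 'I_k.+2) : R := if (i < k)%N then 0 else if (i == k :> nat) then b else - a.
have c0 i : c i = 0.
  apply: free => r rI; rewrite 2!big_ord_recr /= big1 => [|j _].
    by rewrite /c /= ltnn eqxx ltnNge leqnSn /= gtn_eqF// ea// eb//; ring.
  by rewrite /c /= ltn_ord mul0r.
have := c0 ord_max; rewrite /c /= ltnNge leqnSn /= gtn_eqF// => /eqP.
rewrite oppr_eq0 => /eqP a0.
by have [r rI] := free_nonzero k free; rewrite ea// a0 mul0r eqxx.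
Qed.

(** Simplicity of the eigenvalues makes the list strictly increasing.  That every
    zero is at least [nu 0] holds since its eigenfunction, not being zero, is
    a combination of a nonempty set of the listed ones. *)
Lemma eigenvalues_kummer rho B h n (lam : nat -> R) :
  0 < rho -> 0 < B -> 0 < h -> Pm_eigenvalues rho B n%:Z h lam ->
  let nu k := lam k / (2 * h * B) in
  let T := B * rho ^+ 2 / (2 * h) in
  [/\ forall k, kummer (- nu k) n.+1%:R T = 0, forall k, nu k < nu k.+1 &
      forall nu', kummer (- nu') n.+1%:R T = 0 -> nu 0%N <= nu'].
Proof.
move=> rho0 B0 h0 [mono [e [ee free span]]] nu T.
have hB0 : 0 < 2 * h * B by rewrite !mulr_gt0.
have be0 : 0 < B / (2 * h) by rewrite divr_gt0// mulr_gt0.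
split.
- move=> k; apply: (eigenvalue_kummer rho0 B0 h0 (ee k)).
  exact: free_nonzero.
- move=> k; rewrite ltr_pM2r ?invr_gt0// lt_neqAle mono// andbT.
  apply/eqP => E.
  have [a aE] := eigenfunction_radial_sol rho0 B0 h0 (ee k).
  have [b bE] := eigenfunction_radial_sol rho0 B0 h0 (ee k.+1).
  by rewrite -E in bE; exact: free_not_proportional free aE bE.
- move=> nu' nuT.
  have p0 : radial_sol (B / (2 * h)) n nu' rho = 0.
    by apply/eqP; rewrite radial_sol_eq0// mulrAC; apply/eqP.
  have [N [c cE]] := span _ _ (radial_sol_eigenspace rho0 B0 h0 p0).
  have [r rI pr] := radial_sol_nonzero n nu' be0 rho0.
  have [[k /eqP kE]|nk] := pselect (exists k : 'I_N, lam k == 2 * h * B * nu').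
    by rewrite /nu ler_pdivrMr// mulrC -kE mono.
  move: pr; rewrite cE// big_pred0 ?eqxx// => k; apply/negbTE/negP => kE.
  by apply: nk; exists k.
Qed.

Lemma eigenvalues_gt rho B h n (lam : nat -> R) k :
  0 < rho -> 0 < B -> 0 < h -> Pm_eigenvalues rho B n%:Z h lam ->
  2 * h * B * k%:R < lam k.
Proof.
move=> rho0 B0 h0 /(eigenvalues_kummer rho0 B0 h0) [zero inc _].
have hB0 : 0 < 2 * h * B by rewrite !mulr_gt0.
have T0 : 0 < B * rho ^+ 2 / (2 * h) by rewrite divr_gt0 ?mulr_gt0// exprn_gt0.
rewrite mulrC -ltr_pdivlMr//.
apply: (@kummer_eigenvalue_gt _ n _ k (fun k => lam k / (2 * h * B)) T0) => i _.
- exact: zero.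
- exact: inc.
Qed.

Lemma negative_momentum_bound rho B h n la u :
  0 < rho -> 0 < B -> 0 < h -> Pm_eigenspace rho B (- n%:Z) h la u ->
  (exists2 r, 0 < r < rho & u r != 0) -> 2 * n%:R * h * B < la.
Proof.
move=> rho0 B0 h0 eu u0.
have K := eigenvalue_kummer rho0 B0 h0 (eigenspace_opp h0 eu) u0.
have T0 : 0 <= B * rho ^+ 2 / (2 * h) by rewrite divr_ge0 ?mulr_ge0 ?exprn_ge0// ltW.
have n1 : 1 <= n.+1%:R :> R by rewrite ler1n.
have := kummer_zero_gt0 n1 T0 K.
by rewrite pmulr_lgt0 ?invr_gt0 ?mulr_gt0// subr_gt0.
Qed.

Lemma ground_state_asymptotics rho B n (lam : R -> nat -> R) :
  0 < rho -> 0 < B ->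
  (forall h, 0 < h -> Pm_eigenvalues rho B n%:Z h (lam h)) ->
  exists2 eps : R -> R, eps =O_ (0^'+) (fun h : R => h) &
    forall h : R, 0 < h -> lam h 0%N =
      2 * h * B * ((B * rho ^+ 2 / (2 * h)) ^+ n.+1 / n`!%:R)
      * expR (- (B * rho ^+ 2 / (2 * h))) * (1 + eps h).
Proof.
move=> rho0 B0 lamP; have [K K0 asy] := @first_zero_asymptotics R n.
have S0 : 0 < B * rho ^+ 2 by rewrite mulr_gt0// exprn_gt0.
pose T h := B * rho ^+ 2 / (2 * h).
pose nu h := lam h 0%N / (2 * h * B).
exists (fun h => nu h / leading_value n (T h) - 1); last first.
  move=> h h0; rewrite addrC subrK /nu -/(T h).
  have T0 : 0 < T h by rewrite divr_gt0// mulr_gt0.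
  have hB0 : 2 * h * B != 0 by rewrite gt_eqF// !mulr_gt0.
  rewrite -[2 * h * B * _ * _]mulrA -/(leading_value n (T h)).
  by rewrite [_ / leading_value _ _]mulrC mulrA mulfK ?gt_eqF ?leading_value_gt0// mulrC divfK.
apply/eqO_exP; exists (2 * K / (B * rho ^+ 2)).
  by rewrite divr_gt0// mulr_gt0.
near=> h.
have h0 : 0 < h by near: h; exact: nbhs_right_gt.
have hK : h <= B * rho ^+ 2 / (2 * K).
  by near: h; apply: nbhs_right_le; rewrite divr_gt0// mulr_gt0.
have [zero _ least] := eigenvalues_kummer rho0 B0 h0 (lamP h h0).
have KT : K <= T h.
  move: hK; rewrite /T !ler_pdivlMr ?mulr_gt0//; congr is_true; congr (_ <= _); ring.
apply: le_trans (asy _ _ KT (zero 0%N) least) _.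
rewrite (ger0_norm (ltW h0)) /T invf_div le_eqVlt; apply/orP; left; apply/eqP; ring.
Unshelve. all: by end_near. Qed.

End Spectrum.

Theorem theorem5p1 (R : realType) (rho B : R) (rho_gt0 : 0 < rho)
    (B_gt0 : 0 < B) (lam : int -> R -> nat -> R)
    (lamP : forall (m : int) (h : R), 0 < h ->
       Pm_eigenvalues rho B m h (lam m h)) :
  [/\ (forall (m : int) (h : R), m < 0 -> 0 < h ->
         (2 * `|m|%:~R - 1) * h * B <= lam m h 0%N),
      (forall (m : int) (h : R), 0 <= m -> 0 < h ->
         (forall k : nat, 2 * h * B * k%:R <= lam m h k) /\
         2 * h * B <= lam m h 1%N)
    & (forall m : int, 0 <= m ->
         exists2 eps : R -> R,
           eps =O_ (0^'+) (fun h : R => h)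
         & forall h : R, 0 < h ->
             lam m h 0%N =
               2 * h * B
               * ((B * rho ^+ 2 / (2 * h)) ^+ `|m|%N.+1 / (`|m|%N)`!%:R)
               * expR (- (B * rho ^+ 2 / (2 * h)))
               * (1 + eps h))].
Proof.
split.
- move=> m h m0 h0; have mE : m = - (`|m|%N)%:Z by rewrite abszE ltr0_norm// opprK.
  have hB0 : 0 < h * B by rewrite mulr_gt0.
  have [_ [e [ee free _]]] := lamP m h h0.
  have := ee 0%N; rewrite {1}mE => e0.
  have := negative_momentum_bound rho_gt0 B_gt0 h0 e0 (free_nonzero 0%N free).
  rewrite -abszE -[_%:~R]/(`|m|%N%:R) => lt.
  apply: le_trans (ltW lt); rewrite -[leLHS]mulrA -[leRHS]mulrA ler_pM2r//.
  by rewrite gerBl.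
- move=> m h m0 h0; have mE : m = (`|m|%N)%:Z by rewrite gez0_abs.
  have := lamP m h h0; rewrite {1}mE => P.
  have H k := ltW (eigenvalues_gt k rho_gt0 B_gt0 h0 P).
  by split=> //; have := H 1%N; rewrite mulr1.
- move=> m m0; have mE : m = (`|m|%N)%:Z by rewrite gez0_abs.
  apply: ground_state_asymptotics => // h h0.
  by have := lamP m h h0; rewrite {1}mE.
Qed.
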